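(* Under the setup below, consider the function $L(m)=\chi_{mP}$ with values in the space of class functions of $G$, for integers $m\ge 0$. Then $L(m)$ is a quasi-polynomial in $m$ of degree $d$ whose period divides the exponent of $G$. That is, there are class-function-valued periodic functions $L_0(m),\dots,L_d(m)$, each with period dividing the exponent of $G$, with $L(m)=\sum_{i=0}^d L_i(m)m^i$ for all $m\ge0$ and $L_d\neq 0$. Moreover $L(0)$ is the trivial character, and for every positive integer $m$, the value $L(-m):=\sum_{i=0}^d L_i(-m)(-m)^i$ of this quasi-polynomial satisfies $$(-1)^d L(-m)=\chi^*_{mP}\cdot\det(\rho).$$
   Context: Setup. Let $G$ be a finite group acting linearly on a lattice $M'=M\oplus\mathbb{Z}$ of rank $d+1$, such that the projection $M'\to\mathbb{Z}$ onto the second factor is $G$-invariant. Let $P\subseteq M_\mathbb{R}\times\{1\}$ be a $d$-dimensional $G$-invariant lattice polytope, i.e. its vertices lie in $M'$. The group $G$ preserves $M=M\times\{0\}$; let $\rho:G\to GL(M)$ be the induced action and $\det(\rho)$ the corresponding $1$-dimensional character $g\mapsto\det\rho(g)$. For an integer $m\ge1$ we have $mP\subseteq M_\mathbb{R}\times\{m\}$. Let $\chi_{mP}$ be the character of the complex permutation representation of $G$ on the finite set $mP\cap M'$, and let $\chi_{0P}$ be the trivial character. Let $\chi^*_{mP}$ be the permutation character of $G$ on $\mathrm{Int}(mP)\cap M'$, where $\mathrm{Int}$ denotes the relative interior (the interior inside the affine hyperplane $M_\mathbb{R}\times\{m\}$). The exponent of $G$ is the least $N\ge1$ with $g^N=1$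 for all $g\in G$. *)

(* Defs.v *)
From HB Require Import structures.
From mathcomp Require Import all_boot all_order all_algebra all_fingroup all_solvable all_field all_character.
From Stdlib Require Import ClassicalEpsilon.
Set Implicit Arguments. Unset Strict Implicit. Unset Printing Implicit Defensive.
Import Order.TTheory GRing.Theory Num.Theory.
Local Open Scope ring_scope.

Definition pbool (P : Prop) : bool :=
  if excluded_middle_informative P then true else false.

(* The lattice M' = Z^(d+1) is represented by integer column vectors
   'cV[int]_(d + 1); the last coordinate (index [lastc d]) is the
   Z-factor, i.e. the "height" of a point. *)
Definition lastc (d : nat) : 'I_(d + 1) := rshift d ord0.

Definition ratmx (m n : nat) (A : 'M[int]_(m, n)) : 'M[rat]_(m, n) :=
  map_mx (fun z : int => z%:~R) A.

(* y lies in the dilate  k * conv(V)  (convex hull taken with rational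
   coefficients; for lattice/rational points this is the same as with real
   coefficients). *)
Definition in_hull (d : nat) (k : rat) (V : seq 'cV[int]_(d + 1))
    (y : 'cV[rat]_(d + 1)) : Prop :=
  exists lam : 'I_(size V) -> rat,
    (forall i, 0 <= lam i) /\ \sum_(i < size V) lam i = 1 /\
    y = \sum_(i < size V) (k * lam i) *: ratmx (nth 0 V i).

Definition in_mP (d : nat) (V : seq 'cV[int]_(d + 1)) (m : nat)
    (x : 'cV[int]_(d + 1)) : Prop :=
  in_hull m%:R V (ratmx x).

(* x is a lattice point of the relative interior of mP, i.e. of the interior
   of mP inside the affine hyperplane  M_R x {m}  (last coordinate = m). *)
Definition in_int_mP (d : nat) (V : seq 'cV[int]_(d + 1)) (m : nat)
    (x : 'cV[int]_(d + 1)) : Prop :=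
  in_mP V m x /\
  exists e : rat, 0 < e /\
    forall w : 'cV[rat]_(d + 1),
      w (lastc d) 0 = 0 -> (forall i, `|w i 0| <= e) ->
      in_hull m%:R V (ratmx x + w).

(* P = conv(V) is d-dimensional: since V lies in the hyperplane of height 1,
   this means the vertices span Q^(d+1) linearly. *)
Definition full_dim (d : nat) (V : seq 'cV[int]_(d + 1)) : Prop :=
  \rank (\matrix_(i < d + 1, j < size V) ((nth 0 V j) i 0)%:~R : 'M[rat]_(d + 1, size V))
    = (d + 1)%N.

Definition box (n B : nat) : seq 'cV[int]_n :=
  [seq \col_i ((nat_of_ord (f i))%:Z - B%:Z) | f : {ffun 'I_n -> 'I_(B.*2.+1)}].

Definition vbound (d : nat) (V : seq 'cV[int]_(d + 1)) : nat :=
  \max_(v <- V) \max_(i < d + 1) absz (v i ord0).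

(* All lattice points of mP lie in box (m * vbound V); these give the
   permutation characters as fixed-point counts. *)
Definition chiP (gT : finGroupType) (d : nat) (rho : gT -> 'M[int]_(d + 1))
    (V : seq 'cV[int]_(d + 1)) (m : nat) (g : gT) : nat :=
  count (fun x => pbool (in_mP V m x) && (rho g *m x == x)) (box (d + 1) (m * vbound V)).

Definition chiIntP (gT : finGroupType) (d : nat) (rho : gT -> 'M[int]_(d + 1))
    (V : seq 'cV[int]_(d + 1)) (m : nat) (g : gT) : nat :=
  count (fun x => pbool (in_int_mP V m x) && (rho g *m x == x)) (box (d + 1) (m * vbound V)).

(* det(rho)(g): determinant of the induced action on M = M x {0}, i.e. the
   upper-left d x d block (the last row of rho g is e_{d+1}^T). *)
Definition detrho (gT : finGroupType) (d : nat) (rho : gT -> 'M[int]_(d + 1))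
    (g : gT) : int :=
  \det (ulsubmx (rho g : 'M[int]_(d + 1, d + 1))).

Definition qeval (gT : finGroupType) (G : {group gT}) (d : nat)
    (L : 'I_d.+1 -> int -> 'CF(G)) (m : int) : gT -> algC :=
  fun g => \sum_(i < d.+1) L i m g * (m%:~R) ^+ i.

(* Main.v *)
(* For a fixed g put N = exponent G and w_i = sum_(j < N) g^j v_i. A lattice
   point of height m lies in mP and is fixed by g iff it lies in the cone C
   spanned by the w_i, all of which have height N; it is moreover interior to
   mP iff it is in the relative interior of C. Simplicial bases that are
   dual feasible for a generic linear cost triangulate C, and shifting points
   by an infinitesimal generic interior vector z (resp. -z) turns the
   triangulation into a partition of C (resp. of its relative interior) into
   half-open simplicial cones. The lattice points of such a cone are
   r + sum_b n_b w_b with r in a finite set of residues, so that heights are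
   counted by the binomials 'C(t + K, K), whose reflection t -> - t - K - 1
   exchanges the two kinds of half-open cones. This gives
   reciprocity up to the sign (-1)^K with K + 1 the dimension of the space
   fixed by g, and (-1)^(d + K) = det g holds for any matrix of finite order. *)
Require Import Defs.
From HB Require Import structures.
From mathcomp Require Import all_boot all_order all_algebra all_fingroup all_solvable all_field all_character.
From mathcomp Require Import lra ring zify.
Set Implicit Arguments. Unset Strict Implicit. Unset Printing Implicit Defensive.
Import Order.TTheory GRing.Theory Num.Theory.
Local Open Scope ring_scope.

(** The orbit sums are not divided by [N]: they stay integral and all sit at height [N], and this
    fixes the period. The cells need not be unimodular and each has its own denominator [q], but in
    a residue class with digit sum [S] the [n_b] add up to [t = (q m - N S) / (q N)], whose
    integrality depends only on [m] modulo [N]. Equal heights also force the coefficients of any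
    linear relation between generators to sum to zero, which makes the cone pointed and supports the
    linear programming arguments. Reciprocity needs no inclusion-exclusion over faces: the same
    cells serve the cone and its interior, and passing from [z] to [-z] exchanges kept and removed
    facets. The delicate spot is height 0, where the binomial formula of a cell with all facets
    removed gives [(-1)^K] instead of 0. Cells for [z] always keep a facet because [z] has positive
    height; cells for [-z] are only counted at [m > 0]. *)

Local Notation toQ := (map_mx (fun z : int => z%:~R : rat)).

(** * Triangulations of cones by linear programming *)

Lemma small_scale (F : realFieldType) (I : finType) (a u : I -> F) :
  (forall i, 0 < a i) -> exists2 t : F, 0 < t & forall i, t * `|u i| < a i.
Proof.
(* Any [t] below all the ratios [a i / |u i|] works; [1 / (1 + s)] is one, and it avoids a separate
   case for [u i = 0]. *)
move=> a_gt0; pose s := \sum_i `|u i| / a i.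
have s_ge0 : 0 <= s by apply: sumr_ge0 => i _; rewrite divr_ge0 // ltW.
have s1_gt0 : 0 < 1 + s by rewrite ltr_wpDr.
exists (1 + s)^-1 => [|i]; first by rewrite invr_gt0.
rewrite mulrC ltr_pdivrMr // mulrC -ltr_pdivrMr //.
apply: (@le_lt_trans _ _ s); last by rewrite ltrDr.
rewrite /s (bigD1 i) //= lerDl; apply: sumr_ge0 => j _.
by rewrite divr_ge0 // ltW.
Qed.

(** On the moment curve [(1, t, t^2, ...)] each nonzero vector becomes a nonzero polynomial in [t].
    Their product [P] has fewer than [size P] roots, so one of [1, ..., size P] is not a root.
    Generic costs and generic points both come from here. *)
Lemma nonvanishing_powers (F : numFieldType) n (S : seq 'rV[F]_n) :
  0 \notin S ->
  exists2 t : F, 0 < t & forall a, a \in S -> a *m (\col_i t ^+ i) != 0.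
Proof.
move=> S0; pose p (a : 'rV[F]_n) := rVpoly a.
pose P := \prod_(a <- S) p a.
have P0 : P != 0.
  rewrite /P prodf_seq_neq0; apply/allP => a aS /=.
  apply/eqP => pa0; have a0 : a = 0 by rewrite -(rVpolyK a) -/(p a) pa0 linear0.
  by rewrite a0 (negbTE S0) in aS.
pose rs := [seq (i.+1)%:R : F | i <- iota 0 (size P)].
have : ~~ all (root P) rs.
  apply/negP => rsP.
  have := max_poly_roots P0 rsP _; rewrite size_map size_iota ltnn => H.
  suff : false by []. apply: H.
  rewrite map_inj_uniq ?iota_uniq // => i j /eqP; rewrite eqr_nat => /eqP [] //.
case/allPn => t /mapP[i _ ->]; rewrite rootE => Pt; exists i.+1%:R => [|a aS].
  by rewrite ltr0n.
apply: contraNneq Pt => H.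
rewrite /P horner_prod prodf_seq_eq0; apply/hasP; exists a => //=.
rewrite /p (horner_coef_wide _ (size_poly _ _)).
move: H => /matrixP /(_ 0 0); rewrite !mxE => H; apply/eqP; rewrite -[RHS]H.
by apply: eq_bigr => j _; rewrite !mxE coef_rVpoly_ord.
Qed.

Section Triangulation.
Variables (F : realFieldType) (n D : nat) (W : 'M[F]_(n, D)).
Implicit Types (A B : {set 'I_n}) (c : 'cV[F]_n) (x y z : 'rV[F]_D).

Definition in_cone (y : 'rV[F]_D) : Prop :=
  exists2 l : 'rV[F]_n, forall i, 0 <= l 0 i & y = l *m W.

Definition incl (B : {set 'I_n}) : 'M[F]_(#|B|, n) := rowsub enum_val 1%:M.
Definition gens (B : {set 'I_n}) : 'M[F]_(#|B|, D) := incl B *m W.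
Definition is_basis (B : {set 'I_n}) := row_free (gens B) && (W <= gens B)%MS.
Definition coords (B : {set 'I_n}) (y : 'rV[F]_D) : 'rV[F]_#|B| :=
  y *m pinvmx (gens B).
Definition supp (l : 'rV[F]_n) : {set 'I_n} := [set i | l 0 i != 0].
Definition restr (B : {set 'I_n}) (l : 'rV[F]_n) : 'rV[F]_#|B| :=
  \row_b l 0 (enum_val b).

Lemma inclE (B : {set 'I_n}) (u : 'rV[F]_#|B|) b : (u *m incl B) 0 (enum_val b) = u 0 b.
Proof.
rewrite mxE (bigD1 b) //= big1 ?addr0 => [|c cb]; rewrite !mxE ?eqxx ?mulr1 //.
by rewrite (inj_eq enum_val_inj) (negbTE cb) mulr0.
Qed.

Lemma incl_out (B : {set 'I_n}) (m : nat) (u : 'M[F]_(m, #|B|)) k i :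
  i \notin B -> (u *m incl B) k i = 0.
Proof.
move=> iB; rewrite mxE big1 // => c _; rewrite !mxE.
case: eqP => [E|]; rewrite ?mulr0 //.
by move: iB; rewrite -E enum_valP.
Qed.

Lemma restrK (B : {set 'I_n}) l : supp l \subset B -> restr B l *m incl B = l.
Proof.
move=> /subsetP lB; apply/rowP => i; case: (boolP (i \in B)) => iB.
  by rewrite -(enum_rankK_in iB iB) inclE mxE.
rewrite incl_out //; apply/esym/eqP; apply: contraNT iB => li.
by apply: lB; rewrite inE.
Qed.

Lemma supp_incl (B : {set 'I_n}) (u : 'rV[F]_#|B|) : supp (u *m incl B) \subset B.
Proof.
apply/subsetP => i; rewrite inE; apply: contraNT => iB.
by rewrite incl_out.
Qed.

Lemma indepP (B : {set 'I_n}) :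
  reflect (forall mu, supp mu \subset B -> mu *m W = 0 -> mu = 0)
          (row_free (gens B)).
Proof.
apply: (iffP idP) => [fB mu muB muW | H].
  have /row_free_inj inj := fB.
  have : restr B mu *m gens B = 0 *m gens B.
    by rewrite mulmxA restrK // muW mul0mx.
  by move/inj => r0; rewrite -(restrK muB) r0 mul0mx.
apply: inj_row_free => u; rewrite mulmxA => /(H _ (supp_incl u)) u0.
by apply/rowP => b; rewrite -inclE u0 !mxE.
Qed.

Lemma coordsK B y : is_basis B -> (y <= W)%MS -> coords B y *m gens B = y.
Proof. by case/andP=> _ WB yW; rewrite mulmxKpV // (submx_trans yW). Qed.

Lemma gens_sub B : (gens B <= W)%MS.
Proof. exact: submxMl. Qed.

Lemma coordsE B (u : 'rV[F]_#|B|) : is_basis B -> coords B (u *m gens B) = u.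
Proof.
move=> bB; have /andP[/row_free_inj inj _] := bB.
by apply: inj; rewrite coordsK // (submx_trans (submxMl _ _)) // gens_sub.
Qed.

Lemma in_cone_sub y : in_cone y -> (y <= W)%MS.
Proof. by case=> l _ ->; apply: submxMl. Qed.

Lemma card_basis B : is_basis B -> #|B| = \rank W.
Proof.
case/andP=> /eqP fB WB; transitivity (\rank (gens B)); first exact/esym.
by apply/eqP; rewrite eqn_leq !mxrankS // gens_sub.
Qed.

Lemma extend_basis (I : {set 'I_n}) :
  row_free (gens I) -> exists2 B : {set 'I_n}, I \subset B & is_basis B.
Proof.
move=> fI; have [B /maxsetP[fB Bmax] IB] := @maxset_exists _ (fun B => row_free (gens B)) I fI.
exists B => //; rewrite /is_basis fB /=; apply/row_subP => j.
case: (boolP (j \in B)) => jB.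
  have -> : row j W = row (enum_rank_in jB j) (gens B).
    by rewrite row_mul /incl row_rowsub enum_rankK_in // row1 rowE.
  exact: row_sub.
have : ~~ row_free (gens (j |: B)).
  apply/negP => /Bmax /(_ (subsetUr _ _)) E.
  by move: jB; rewrite -E setU11.
move=> /indepP nf; apply/negPn/negP => jW; apply: nf => mu muB muW.
have mu0 : mu 0 j = 0.
  apply/eqP; apply: contraNT jW => mj.
  pose nu := mu - mu 0 j *: delta_mx 0 j.
  have nuB : supp nu \subset B.
    apply/subsetP => i; rewrite inE !mxE eqxx /=.
    case: (eqVneq i j) => [->|ij]; first by rewrite mulr1 subrr eqxx.
    rewrite mulr0 subr0 => mi; move/subsetP: muB => /(_ i).
    by rewrite !inE mi (negbTE ij) => /(_ isT).
  have : nu *m W = - (mu 0 j *: row j W).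
    by rewrite mulmxBl muW sub0r -scalemxAl rowE.
  move/(congr1 (fun x => - (mu 0 j)^-1 *: x)).
  rewrite scalerN !scaleNr opprK scalerA mulVf // scale1r => <-.
  by rewrite -(restrK nuB) -mulmxA -scaleNr scalemx_sub // submxMl.
apply: (indepP _ fB) => //; apply/subsetP => i; rewrite inE => mi.
move/subsetP: muB => /(_ i); rewrite !inE mi => /(_ isT) /orP[/eqP ij|//].
by move: mi; rewrite ij mu0 eqxx.
Qed.

Hypothesis sum_rel : forall mu : 'rV[F]_n, mu *m W = 0 -> \sum_i mu 0 i = 0.

(** Pointedness of the cone: entries with sum zero cannot all be nonnegative unless they vanish. It
    applies to [- mu] as well, so the sign of a relation may be chosen according to its cost. *)
Lemma relation_neg (mu : 'rV[F]_n) : mu != 0 -> mu *m W = 0 -> exists i, mu 0 i < 0.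
Proof.
move=> mu0 /sum_rel s0; case: (boolP [exists i, mu 0 i < 0]) => [/existsP//|].
rewrite negb_exists => /forallP ge0; case/negP: mu0; apply/eqP/rowP => i.
have mu_ge0 j : 0 <= mu 0 j by rewrite leNgt ge0.
have /eqP := s0; rewrite psumr_eq0 // => /allP /(_ i).
by rewrite mem_index_enum mxE => /(_ isT)/eqP.
Qed.

(* Caratheodory's theorem, moving along relations that do not increase the cost. *)
Lemma caratheodory (c : 'cV[F]_n) (l : 'rV[F]_n) :
  (forall i, 0 <= l 0 i) ->
  exists l' : 'rV[F]_n, [/\ forall i, 0 <= l' 0 i, l' *m W = l *m W,
    (l' *m c) 0 0 <= (l *m c) 0 0 & row_free (gens (supp l'))].
Proof.
have [k] := ubnP #|supp l|; elim: k l => // k IH l lk l_ge0.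
case: (boolP (row_free (gens (supp l)))) => fl; first by exists l; split.
have [mu [mu0 muW mul muc]] : exists mu : 'rV[F]_n,
    [/\ mu != 0, mu *m W = 0, supp mu \subset supp l & (mu *m c) 0 0 <= 0].
  have [mu [mu0 muW mul]] : exists mu : 'rV[F]_n,
    [/\ mu != 0, mu *m W = 0 & supp mu \subset supp l].
    move: fl; rewrite -kermx_eq0 => /rowV0Pn[u /sub_kermxP uk u0].
    exists (u *m incl (supp l)); rewrite -mulmxA uk supp_incl; split=> //.
    apply: contraNneq u0 => u0; apply/eqP/rowP => b.
    by rewrite -inclE u0 !mxE.
  have [muc|muc] := lerP ((mu *m c) 0 0) 0; first by exists mu.
  exists (- mu); rewrite oppr_eq0 mu0 mulNmx muW oppr0; split=> //.
    by apply/subsetP => i; rewrite inE mxE oppr_eq0 => mi; apply: (subsetP mul); rewrite inE.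
  by rewrite mulNmx mxE oppr_le0 ltW.
have [i0 i0neg] := relation_neg mu0 muW.
(* Ratio test: [i] is the first coordinate to reach zero along [mu], so the support shrinks while
   all entries stay nonnegative. *)
have [i ineg imin] := @arg_minP _ _ _ i0 (fun i => mu 0 i < 0)
                        (fun i => l 0 i / - mu 0 i) i0neg.
set th := l 0 i / - mu 0 i in imin.
have th_ge0 : 0 <= th by rewrite divr_ge0 // oppr_ge0 ltW.
pose l1 := l + th *: mu.
have l1_ge0 j : 0 <= l1 0 j.
  rewrite !mxE; have [muj|muj] := lerP 0 (mu 0 j).
    by rewrite addr_ge0 // mulr_ge0.
  have := imin j muj; rewrite ler_pdivlMr ?oppr_gt0 // => H.
  lra.
have l1W : l1 *m W = l *m W by rewrite mulmxDl -scalemxAl muW scaler0 addr0.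
have l1c : (l1 *m c) 0 0 <= (l *m c) 0 0.
  by rewrite mulmxDl -scalemxAl mxE gerDl mxE mulr_ge0_le0.
have [||l2 [l2_ge0 l2W l2c l2f]] := IH l1 => //.
  rewrite -ltnS; apply: leq_trans lk; rewrite ltnS; apply: proper_card.
  apply/properP; split.
    apply/subsetP => j; rewrite !inE !mxE; apply: contraNneq => lj.
    have : j \notin supp l by rewrite inE lj eqxx.
    move/(contra (subsetP mul j)); rewrite inE negbK => /eqP ->.
    by rewrite lj mulr0 addr0.
  exists i; first by apply: (subsetP mul); rewrite inE lt_eqF.
  rewrite inE !mxE negbK /th invrN mulrN mulNr mulfVK ?subrr //.
  by rewrite lt_eqF.
exists l2; split=> //; first by rewrite l2W.
exact: le_trans l1c.
Qed.

(** The reduced cost of the simplex method: the cost of generator [j] minus the cost of its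
    expression in the basis [B]. *)
Definition redcost (c : 'cV[F]_n) (B : {set 'I_n}) : 'cV[F]_n :=
  (1%:M - W *m pinvmx (gens B) *m incl B) *m c.
Definition cost (c : 'cV[F]_n) (B : {set 'I_n}) (y : 'rV[F]_D) : F :=
  (coords B y *m incl B *m c) 0 0.
(** For generic [c] these are the maximal cells of the regular triangulation: the lower faces after
    lifting generator [i] to height [c i]. *)
Definition dual_feasible (c : 'cV[F]_n) (B : {set 'I_n}) :=
  is_basis B && [forall j, (j \notin B) ==> (0 < redcost c B j 0)].

Lemma cost_redcost c B (l : 'rV[F]_n) :
  (l *m c) 0 0 = cost c B (l *m W) + (l *m redcost c B) 0 0.
Proof.
rewrite /cost /redcost /coords mulmxBl mul1mx mulmxBr !mulmxA !mxE.
lra.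
Qed.

Lemma redcost_in c B j : is_basis B -> j \in B -> redcost c B j 0 = 0.
Proof.
move=> bB jB.
have := cost_redcost c B (delta_mx 0 j).
rewrite -!rowE !mxE /cost.
have -> : row j W = delta_mx 0 (enum_rank_in jB j) *m gens B.
  by rewrite mulmxA -[_ *m incl B]rowE /incl row_rowsub enum_rankK_in // row1 rowE.
rewrite coordsE // -[_ *m incl B]rowE /incl row_rowsub enum_rankK_in // row1 -rowE !mxE.
lra.
Qed.

Definition generic_cost (c : 'cV[F]_n) :=
  forall B j, is_basis B -> j \notin B -> redcost c B j 0 != 0.
Definition generic_point (y : 'rV[F]_D) :=
  forall B b, is_basis B -> coords B y 0 b != 0.
Definition pos_coords (B : {set 'I_n}) (y : 'rV[F]_D) :=
  [forall b, 0 < coords B y 0 b].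

Lemma pos_coords_cone B y : is_basis B -> (y <= W)%MS ->
  (forall b, 0 <= coords B y 0 b) -> in_cone y.
Proof.
move=> bB yW pos; exists (coords B y *m incl B); last by rewrite -mulmxA coordsK.
move=> i; case: (boolP (i \in B)) => iB; last by rewrite incl_out.
by rewrite -(enum_rankK_in iB iB) inclE pos.
Qed.

(** A basis extending the independent support found by [caratheodory] has nonnegative coordinates at
    [y]; genericity of [y] makes them positive. *)
Lemma cheap_basis c (l : 'rV[F]_n) (y := l *m W) :
  generic_point y -> (forall i, 0 <= l 0 i) ->
  exists B, [/\ is_basis B, pos_coords B y & cost c B y <= (l *m c) 0 0].
Proof.
move=> gy l_ge0; have [l' [l'_ge0 l'W l'c /extend_basis[B lB bB]]] := caratheodory c l_ge0.
have E : restr B l' = coords B y by rewrite /y -l'W -(restrK lB) -mulmxA coordsE // restrK.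
exists B; split=> //; last by rewrite /cost -E restrK.
apply/forallP => b; rewrite lt_def gy //= -E mxE; exact: l'_ge0.
Qed.

(** The cheapest basis with positive coordinates at [y] is dual feasible: if [j] had negative
    reduced cost, bringing in a little of generator [j] would lower the cost, and [cheap_basis]
    would turn the result into a cheaper basis. *)
Lemma triangulation_cover c y : generic_cost c -> generic_point y -> in_cone y ->
  exists2 B, dual_feasible c B & pos_coords B y.
Proof.
move=> gc gy [l l_ge0 yl].
have [B0 [bB0 pB0 _]] : exists B, [/\ is_basis B, pos_coords B y & cost c B y <= (l *m c) 0 0].
  by rewrite yl; apply: cheap_basis => //; rewrite -yl.
have [B /andP[bB pB] Bmin] := @arg_minP _ _ _ B0 (fun B => is_basis B && pos_coords B y)
   (fun B => cost c B y) (introT andP (conj bB0 pB0)).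
exists B => //; rewrite /dual_feasible bB /=; apply/forallP => j; apply/implyP => jB.
rewrite lt_def gc //= leNgt; apply/negP => rj.
have yW : (y <= W)%MS by rewrite yl submxMl.
pose u := coords B (row j W) *m incl B; pose lam := coords B y *m incl B.
have [t t_gt0 tu] := @small_scale F 'I_#|B| (coords B y 0) (coords B (row j W) 0) (forallP pB).
pose l1 := lam + t *: (delta_mx 0 j - u).
have l1W : l1 *m W = y.
  have gE (v : 'rV[F]_#|B|) : v *m incl B *m W = v *m gens B by rewrite mulmxA.
  by rewrite /l1 /lam /u mulmxDl -scalemxAl mulmxBl -rowE !gE !coordsK ?row_sub // subrr scaler0 addr0.
have l1E i : l1 0 i = lam 0 i + t * ((i == j)%:R - u 0 i).
  rewrite mxE; congr (_ + _); rewrite mxE; congr (_ * _); rewrite mxE.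
  by congr (_ + _); rewrite mxE ?eqxx.
have l1_ge0 i : 0 <= l1 0 i.
  rewrite l1E; case: (boolP (i \in B)) => iB.
    have -> : (i == j) = false by apply/negP => /eqP ij; rewrite ij (negbTE jB) in iB.
    rewrite -(enum_rankK_in iB iB) !inclE.
    rewrite sub0r mulrN subr_ge0; apply: le_trans (ltW (tu _)).
    by rewrite ler_wpM2l ?ler_norm ?ltW.
  by rewrite /lam /u !incl_out // add0r subr0 mulr_ge0 ?ler0n ?ltW.
have gl1 : generic_point (l1 *m W) by rewrite l1W.
have [B1 [bB1 pB1 cB1]] := cheap_basis c gl1 l1_ge0.
rewrite l1W in pB1 cB1.
have := Bmin B1; rewrite bB1 pB1 => /(_ isT) /le_trans /(_ cB1).
rewrite (cost_redcost c B l1) l1W lerDl leNgt => /negP; apply.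
rewrite /l1 mulmxDl -scalemxAl mulmxBl -rowE.
have z (v : 'rV[F]_#|B|) : v *m incl B *m redcost c B = 0.
  apply/matrixP => a b; rewrite !mxE big1 // => k _.
  rewrite !ord1; case: (boolP (k \in B)) => kB; first by rewrite redcost_in // mulr0.
  by rewrite incl_out // mul0r.
by rewrite /u /lam !z subr0 add0r mxE pmulr_rlt0 // mxE.
Qed.

(** By [cost_redcost], expressing [y] in [A'] costs as much as in [A] plus the reduced costs of [A]
    weighted by the positive coordinates on [A']; the excess vanishes only if [A'] lies in [A].
    Exchanging roles gives equal costs, and all bases have the same size. *)
Lemma triangulation_disjoint c y B B' : (y <= W)%MS ->
  dual_feasible c B -> dual_feasible c B' -> pos_coords B y -> pos_coords B' y -> B = B'.
Proof.
move=> yW dB dB' pB pB'.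
have key A A' : dual_feasible c A -> dual_feasible c A' -> pos_coords A y ->
   pos_coords A' y -> cost c A y <= cost c A' y ?= iff (A' \subset A).
  move=> /andP[bA /forallP rA] /andP[bA' _] /forallP pA /forallP pA'.
  have -> : cost c A' y = cost c A y + (coords A' y *m incl A' *m redcost c A) 0 0.
    by rewrite {1}/cost (cost_redcost c A) -mulmxA coordsK.
  have ge0 k : 0 <= (coords A' y *m incl A') 0 k * redcost c A k 0.
    case: (boolP (k \in A)) => kA; first by rewrite redcost_in // mulr0.
    rewrite mulr_ge0 //; last by have := rA k; rewrite kA => /ltW.
    case: (boolP (k \in A')) => kA'; last by rewrite incl_out.
    by rewrite -(enum_rankK_in kA' kA') inclE ltW.
  apply/leifP; case: ifP => sub.
    rewrite [X in _ + X]mxE big1 ?addr0 // => k _.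
    case: (boolP (k \in A)) => kA; first by rewrite redcost_in // mulr0.
    rewrite incl_out ?mul0r //; apply: contra kA; exact: (subsetP sub).
  have /subsetPn[k kA' kA] := negbT sub.
  rewrite ltrDl mxE (bigD1 k) //= ltr_pwDl ?sumr_ge0 // mulr_gt0 //.
    by rewrite -(enum_rankK_in kA' kA') inclE.
  by have := rA k; rewrite kA.
have [bB _] := andP dB; have [bB' _] := andP dB'.
have H1 := key _ _ dB dB' pB pB'; have H2 := key _ _ dB' dB pB' pB.
have E : cost c B y = cost c B' y by apply/eqP; rewrite eq_le (leif_le H1) (leif_le H2).
apply/eqP; rewrite eq_sym eqEcard (card_basis bB) (card_basis bB') leqnn andbT.
by rewrite -(H1.2) E eqxx.
Qed.

(** * Half-open cells and the partitions of the cone and of its interior *)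

Definition half_open (z : 'rV[F]_D) (B : {set 'I_n}) (x : 'rV[F]_D) :=
  [forall b, if 0 < coords B z 0 b then 0 <= coords B x 0 b else 0 < coords B x 0 b].

Lemma half_open_cone z B x : is_basis B -> (x <= W)%MS -> half_open z B x -> in_cone x.
Proof.
move=> bB xW /forallP ho; apply: (pos_coords_cone bB xW) => b.
by have := ho b; case: ifP => // _ /ltW.
Qed.

(** Under a small shift a nonzero coordinate of [x] keeps its sign, and a zero one takes the sign of
    the coordinate of [z], which is never zero. A single [s0] serves all bases because there are
    finitely many pairs of a basis and a coordinate. *)
Lemma half_open_shift z x : generic_point z ->
  exists2 s0 : F, 0 < s0 & forall s, 0 < s <= s0 ->
    generic_point (x + s *: z) /\
    forall B, is_basis B -> pos_coords B (x + s *: z) = half_open z B x.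
Proof.
move=> gz.
pose I : finType := {B : {set 'I_n} & 'I_#|B|}.
pose xi (i : I) := coords (tag i) x 0 (tagged i).
pose zi (i : I) := coords (tag i) z 0 (tagged i).
(* A zero coordinate needs no bound on [s]; the value 1 just keeps [a] positive. *)
pose a i := if xi i == 0 then 1 else `|xi i|.
have a_gt0 i : 0 < a i by rewrite /a; case: eqP => // /eqP; rewrite normr_gt0.
have [s0 s0_gt0 sz] := small_scale zi a_gt0.
exists s0 => // s /andP[s_gt0 ss0].
have E B b : coords B (x + s *: z) 0 b = coords B x 0 b + s * coords B z 0 b.
  by rewrite /coords mulmxDl -scalemxAl !mxE.
have small B b : coords B x 0 b != 0 -> s * `|coords B z 0 b| < `|coords B x 0 b|.
  move=> xb; have := sz (Tagged (fun B : {set 'I_n} => 'I_#|B|) b : I).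
  rewrite /a /xi /zi /= (negbTE xb); apply: le_lt_trans.
  by rewrite ler_wpM2r.
split=> [B b bB|B bB].
  rewrite E; case: (eqVneq (coords B x 0 b) 0) => [->|xb].
    by rewrite add0r mulf_eq0 negb_or (gt_eqF s_gt0) gz.
  rewrite addr_eq0; apply/eqP => xE; have := small B b xb.
  by rewrite xE normrN normrM gtr0_norm // ltxx.
rewrite /pos_coords /half_open; apply: eq_forallb => b; rewrite E.
have := small B b; have := gz B b bB; move: (coords B x 0 b) (coords B z 0 b) => u v v0 sm.
case: (ltrgtP 0 u) => [u0|u0|u0].
- have := sm (lt0r_neq0 u0); rewrite (gtr0_norm u0) => smu.
  have := ler_norm (- v); rewrite normrN => H.
  have -> : 0 < u + s * v by nra.
  by case: ifP => // _; rewrite ltW.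
- have := sm (ltr0_neq0 u0); rewrite (ltr0_norm u0) => smu.
  have := ler_norm v => H.
  have -> : (0 < u + s * v) = false by apply/negbTE; rewrite -leNgt; nra.
  by case: ifP.
- by rewrite -u0 add0r pmulr_rgt0 //; case: ifP; rewrite ?lexx ?ltxx.
Qed.

(* The open simplicial cones of a triangulation partition the generic points
   of the cone; [x + s z] is generic for all small [s > 0], and lies in such an
   open cone exactly when [x] lies in its half-open version. *)
Lemma sum_half_open c z x : generic_cost c -> generic_point z ->
  (z <= W)%MS -> (x <= W)%MS ->
  exists2 s0 : F, 0 < s0 & forall s b, 0 < s <= s0 ->
    reflect (in_cone (x + s *: z)) b ->
    (\sum_(B | dual_feasible c B) half_open z B x = b)%N.
Proof.
move=> gc gz zW xW; have [s0 s0_gt0 H] := half_open_shift x gz.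
exists s0 => // s b ss0 bP; have [gy Hy] := H _ ss0.
have yW : ((x + s *: z)%R <= W)%MS by rewrite addmx_sub // scalemx_sub.
have EH B : dual_feasible c B -> half_open z B x = pos_coords B (x + s *: z).
  by case/andP=> bB _; rewrite Hy.
case: bP => [/(triangulation_cover gc gy)[B dB pB] | yC].
  rewrite (bigD1 B) //= EH // pB big1 // => B' /andP[dB' BB'].
  rewrite EH //; case: (boolP (pos_coords B' _)) => // pB'.
  by rewrite (triangulation_disjoint yW dB dB' pB pB') eqxx in BB'.
apply: big1 => B dB; rewrite EH //; case: (boolP (pos_coords B _)) => // pB.
case: yC; apply: (@pos_coords_cone B) => //; first by case/andP: dB.
by move=> b'; apply/ltW/(forallP pB).
Qed.

(** When [z] is a strictly positive combination of the generators, this is the relative interior of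
    the cone, expressed without topology. *)
Definition in_relint z x : Prop := exists2 s : F, 0 < s & in_cone (x - s *: z).

Lemma in_coneD x y : in_cone x -> in_cone y -> in_cone (x + y).
Proof.
case=> [l l0 ->] [l' l'0 ->]; exists (l + l'); last by rewrite mulmxDl.
by move=> i; rewrite mxE addr_ge0.
Qed.

Lemma in_coneZ (a : F) x : 0 <= a -> in_cone x -> in_cone (a *: x).
Proof.
move=> a0 [l l0 ->]; exists (a *: l); last by rewrite scalemxAl.
by move=> i; rewrite mxE mulr_ge0.
Qed.

(** If [x] is in the cone then so is [x + s z], and exactly one cell contains [x]; otherwise no cell
    does, since half-open cells lie inside the cone. *)
Lemma cone_decomposition c z x b : generic_cost c -> generic_point z -> in_cone z ->
  reflect (in_cone x) b ->
  (\sum_(B | dual_feasible c B) ((x <= W)%MS && half_open z B x) = b)%N.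
Proof.
move=> gc gz zC bP; case: (boolP (x <= W)%MS) => xW; last first.
  rewrite big1 //; case: bP => // /in_cone_sub; by rewrite (negbTE xW).
have zW := in_cone_sub zC.
have [s0 s0_gt0 H] := sum_half_open gc gz zW xW.
case: bP => [xC|xC].
  apply: (H s0); first by rewrite s0_gt0 lexx.
  by left; apply: in_coneD => //; apply: in_coneZ => //; apply: ltW.
apply: big1 => B /andP[bB _] /=; case: (boolP (half_open z B x)) => // /(half_open_cone bB xW).
by move/xC.
Qed.

Lemma generic_pointN z : generic_point z -> generic_point (- z).
Proof. by move=> gz B b bB; rewrite /coords mulNmx mxE oppr_eq0 gz. Qed.

(** If [x - s z] is in the cone, it remains there for smaller [s]; a witness of [in_relint] can thus
    be shrunk below the threshold of [sum_half_open] for [- z]. *)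
Lemma relint_decomposition c z x b : generic_cost c -> generic_point z -> in_cone z ->
  reflect (in_relint z x) b ->
  (\sum_(B | dual_feasible c B) ((x <= W)%MS && half_open (- z) B x) = b)%N.
Proof.
move=> gc gz zC bP; have zW := in_cone_sub zC.
case: (boolP (x <= W)%MS) => xW; last first.
  rewrite big1 //; case: bP => // -[s _ /in_cone_sub xsW]; case/negP: xW.
  by rewrite -(subrK (s *: z) x) addmx_sub // scalemx_sub.
have NzW : (- z <= W)%MS by rewrite eqmx_opp.
have [s0 s0_gt0 H] := sum_half_open gc (generic_pointN gz) NzW xW.
case: bP => [[s s_gt0 xs]|xC].
  pose s' := Num.min s s0; have s'_gt0 : 0 < s' by rewrite lt_min s_gt0.
  apply: (H s'); first by rewrite s'_gt0 ge_min lexx orbT.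
  left; have -> : x + s' *: - z = (x - s *: z) + (s - s') *: z.
    by rewrite scalerN scalerBl addrA subrK.
  by apply: in_coneD => //; apply: in_coneZ => //; rewrite subr_ge0 ge_min lexx.
apply: (H s0); first by rewrite s0_gt0 lexx.
by right=> C; apply: xC; exists s0 => //; rewrite -scalerN.
Qed.

(** * Existence of generic costs and generic points *)

Lemma generic_cost_exists : exists c, generic_cost c.
Proof.
pose r B : 'M_n := 1%:M - W *m pinvmx (gens B) *m incl B.
pose S := [seq row p.2 (r p.1) | p : {set 'I_n} * 'I_n <- enum {: {set 'I_n} * 'I_n} & p.2 \notin p.1].
have S0 : 0 \notin S.
  apply/negP => /mapP[[B j] /=]; rewrite mem_filter /= => /andP[jB _].
  (* The linear form giving the reduced cost at [j] has coefficient 1 at [c j], because the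
     expression in [B] does not involve [j]. *)
  have rj : r B j j = 1.
    by rewrite /r mxE [X in _ + X]mxE incl_out // subr0 mxE eqxx.
  move/rowP/(_ j); rewrite [RHS]mxE rj mxE => /esym/eqP.
  by rewrite oner_eq0.
have [t _ tP] := nonvanishing_powers S0.
exists (\col_i t ^+ i) => B j _ jB.
have /tP : row j (r B) \in S by apply/mapP; exists (B, j) => //; rewrite mem_filter jB mem_enum.
by apply: contraNneq => H; apply/eqP/rowP => k; rewrite !ord1 -row_mul mxE H mxE.
Qed.

Lemma generic_point_exists :
  exists2 l : 'rV[F]_n, forall i, 0 < l 0 i & generic_point (l *m W).
Proof.
pose a B (b : 'I_#|B|) : 'rV_n := (col b (W *m pinvmx (gens B)))^T.
pose S := [seq a (tag p) (tagged p) | p in [pred p : {B : {set 'I_n} & 'I_#|B|} | is_basis (tag p)]].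
(* As a linear form in [l], the coordinate [b] takes the value 1 at the unit vector of generator
   [enum_val b]. *)
have S0 : 0 \notin S.
  apply/negP => /imageP[[B b] /= bB]; move: (bB); rewrite inE /= => {}bB.
  move/rowP/(_ (enum_val b)) => H.
  have := coordsE (delta_mx 0 b) bB; rewrite mulmxA -[_ *m incl B]rowE /incl row_rowsub row1.
  rewrite /coords -mulmxA => /rowP/(_ b); rewrite -rowE mxE.
  move: H; rewrite !mxE => <-; rewrite !eqxx => /eqP.
  by rewrite eq_sym oner_eq0.
have [t t_gt0 tP] := nonvanishing_powers S0.
exists (\row_i t ^+ i) => [i|B b bB]; first by rewrite mxE exprn_gt0.
have /tP : a B b \in S.
  by apply/imageP; exists (Tagged (fun B : {set 'I_n} => 'I_#|B|) b).
apply: contraNneq => H; apply/eqP/rowP => k; rewrite !ord1 [RHS]mxE -[RHS]H.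
rewrite /coords -mulmxA [LHS]mxE [RHS]mxE; apply: eq_bigr => i _.
by rewrite !mxE mulrC.
Qed.

End Triangulation.

(** * Counting lattice points of half-open simplicial cones *)

Lemma common_denominator m n (A : 'M[rat]_(m, n)) :
  exists2 q : nat, (0 < q)%N & exists Z : 'M[int]_(m, n), q%:R *: A = toQ Z.
Proof.
pose q := (\prod_(p : 'I_m * 'I_n) `|denq (A p.1 p.2)|)%N.
exists q; first by rewrite prodn_gt0 // => p; rewrite absz_gt0 denq_neq0.
exists (\matrix_(i, j) (numq (A i j) *
   (\prod_(p : 'I_m * 'I_n | p != (i, j)) `|denq (A p.1 p.2)|)%N%:Z)).
apply/matrixP => i j; rewrite !mxE /q (bigD1 (i, j)) //= natrM intrM numqE.
rewrite -!pmulrn natr_absz (gtr0_norm (denq_gt0 _)); ring.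
Qed.

Lemma card_compositions K M t : (t <= M)%N ->
  #|[set n : {ffun 'I_K.+1 -> 'I_M.+1} | (\sum_b n b == t)%N]| = 'C(K + t, K).
Proof.
move=> tM; rewrite -card_ord_partitions.
pose f (u : K.+1.-tuple 'I_t.+1) : {ffun 'I_K.+1 -> 'I_M.+1} := [ffun b => inord (tnth u b)].
have fE u b : f u b = tnth u b :> nat.
  by rewrite ffunE inordK // ltnS (leq_trans _ tM) // -ltnS.
rewrite -(card_imset _ (_ : injective f)); last first.
  move=> u v uv; apply: eq_from_tnth => b; apply: val_inj.
  by rewrite /= -!fE uv.
apply: eq_card => n; rewrite inE; apply/idP/imsetP => [/eqP nt|[u]].
  have nb b : (n b <= t)%N by rewrite -nt (bigD1 b) //= leq_addr.
  pose u := [tuple inord (n b) : 'I_t.+1 | b < K.+1].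
  have uE b : tnth u b = n b :> nat by rewrite tnth_mktuple inordK // ltnS.
  exists u; last by apply/ffunP => b; apply: val_inj; rewrite /= fE uE.
  rewrite inE big_tuple; apply/eqP; rewrite -[RHS]nt; apply: eq_bigr => b _; exact: uE.
rewrite inE big_tuple => /eqP ut ->; apply/eqP; rewrite -[RHS]ut.
by apply: eq_bigr => b _; exact: fE.
Qed.

Lemma linear_prod_coef (R : idomainType) K (a : R) (c : nat -> R) :
  let p := \prod_(i < K) (a *: 'X + (c i)%:P) in
  (size p <= K.+1)%N /\ p`_K = a ^+ K.
Proof.
elim: K => [|K [IHs IHc]] /=; first by rewrite big_ord0 size_poly1 coef1.
rewrite big_ord_recr /=; set p := \prod_(i < K) _ in IHs IHc *.
have E : p * (a *: 'X + (c K)%:P) = (a *: p) * 'X + c K *: p.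
  by rewrite mulrDr -scalerAr scalerAl [p * _%:P]mulrC mul_polyC.
rewrite E; split.
  apply: leq_trans (size_polyD _ _) _; rewrite geq_max; apply/andP; split.
    apply: leq_trans (size_polyMleq _ _) _; rewrite size_polyX addn2 /= ltnS.
    by apply: leq_trans (size_scale_leq _ _) _.
  by apply: leq_trans (size_scale_leq _ _) _; apply: leq_trans IHs _.
rewrite coefD coefMX /= !coefZ IHc exprS [p`_K.+1]nth_default ?mulr0 ?addr0 //.
Qed.

Section Binomial.
Variable R : numFieldType.

(** The polynomial in [t] that extends ['C(K + t, K)] to negative arguments. *)
Definition binR K (t : R) : R := (K`!%:R)^-1 * \prod_(i < K) (t + i.+1%:R).

Lemma fact0 K : K`!%:R != 0 :> R.
Proof. by rewrite pnatr_eq0 -lt0n fact_gt0. Qed.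

Lemma binR_nat K (t : nat) : binR K t%:R = 'C(K + t, K)%:R.
Proof.
rewrite /binR; apply: (mulfI (fact0 K)); rewrite mulrA divff ?fact0 // mul1r.
rewrite -natrM mulnC bin_ffact.
have -> : \prod_(i < K) (t%:R + i.+1%:R) = (\prod_(i < K) (t + i.+1))%N%:R :> R.
  by rewrite natr_prod; apply: eq_bigr => i _; rewrite natrD.
congr (_%:R); rewrite ffact_prod (reindex_inj rev_ord_inj) /=.
by apply: eq_bigr => i _; have := ltn_ord i; lia.
Qed.

Lemma binR_reflect K (t : R) : binR K (- t - K.+1%:R) = (-1) ^+ K * binR K t.
Proof.
rewrite /binR mulrCA; congr (_ * _); rewrite (reindex_inj rev_ord_inj) /=.
rewrite -[in X in _ = X * _](card_ord K) -prodrN.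
apply: eq_bigr => i _; have -> : (K.+1%:R : R) = (K - i.+1).+1%:R + i.+1%:R.
  by rewrite -natrD; congr (_%:R); have := ltn_ord i; lia.
ring.
Qed.

(** The roots are [-1, ..., -K]. The lower bound is strict since the value at [-(K + 1)] is
    [(-1)^K]. *)
Lemma binR_negative K (t : int) : - K.+1%:Z < t -> t < 0 -> binR K t%:~R = 0.
Proof.
move=> tK t0; rewrite /binR.
have [i ti] : exists i : 'I_K, t = - i.+1%:Z.
  have iK : (`|t|.-1 < K)%N by lia.
  by exists (Ordinal iK) => /=; lia.
by rewrite (bigD1 i) //= ti mulrNz addNr mul0r mulr0.
Qed.

End Binomial.

Section HalfOpenCount.
Variables (K D N q : nat) (X : 'M[int]_(K.+1, D)) (h : 'I_D) (Z : 'M[int]_(D, K.+1)).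
Hypotheses (N_gt0 : (0 < N)%N) (q_gt0 : (0 < q)%N) (X_free : row_free (toQ X)).
Hypotheses (Xh : forall b, X b h = N%:Z) (qZ : q%:R *: pinvmx (toQ X) = toQ Z).
Implicit Types (o : 'I_K.+1 -> bool) (x : 'rV[int]_D).
Notation res := {ffun 'I_K.+1 -> 'I_q}.

Definition int_coords x : 'rV[rat]_K.+1 := toQ x *m pinvmx (toQ X).
Definition in_half_open o x : bool :=
  (toQ x <= toQ X)%MS &&
  [forall b, if o b then 0 < int_coords x 0 b else 0 <= int_coords x 0 b].
(* Coordinates scaled by the common denominator [q] are written [q n + r + o b],
   with [r] a residue and [o b = 1] when the facet opposite to [b] is removed. *)
Definition lattice_res o (r : res) : bool :=
  [forall i, (q%:Z %| \sum_b (r b + o b)%N%:Z * X b i)%Z].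
Definition res_sum o (r : res) : nat := (\sum_b (r b + o b))%N.

Lemma toQ_M m n p (A : 'M[int]_(m, n)) (B : 'M[int]_(n, p)) : toQ (A *m B) = toQ A *m toQ B.
Proof.
by apply/matrixP => i j; rewrite !mxE rmorph_sum; apply: eq_bigr => k _ /=; rewrite !mxE intrM.
Qed.

Lemma toQ_inj m n : injective (toQ : 'M[int]_(m, n) -> 'M[rat]_(m, n)).
Proof.
move=> A B /matrixP AB; apply/matrixP => i j; have := AB i j; rewrite !mxE.
by move/eqP; rewrite eqr_int => /eqP.
Qed.

(** Division with remainder by [q], after subtracting [o], turns the scaled coordinates of a lattice
    point into a pair [(r, n)]. The height equation makes [N] times the sum of the scaled
    coordinates equal to [q m], so every [n b] is at most [m]. *)
Lemma count_half_open_card o (m : nat) (L : seq 'rV[int]_D) : uniq L ->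
  (forall x, in_half_open o x -> x 0 h = m%:Z -> x \in L) ->
  count (fun x => in_half_open o x && (x 0 h == m%:Z)) L =
  (\sum_(r : res | lattice_res o r)
    #|[set n : {ffun 'I_K.+1 -> 'I_m.+1} |
        N * (q * \sum_b n b + res_sum o r) == q * m]|)%N.
Proof.
move=> L_uniq L_all.
pose T : finType := (res * {ffun 'I_K.+1 -> 'I_m.+1})%type.
pose y (p : T) b : nat := (q * p.2 b + (p.1 b + o b))%N.
pose yX (p : T) : 'rV[int]_D := \row_i (\sum_b (y p b)%:Z * X b i).
pose G (p : T) : 'rV[int]_D := \row_i divz (yX p 0 i) q%:Z.
pose A : {set T} := [set p : T | lattice_res o p.1 &&
   (N * (q * \sum_b p.2 b + res_sum o p.1) == q * m)%N].
have q0 : q%:R != 0 :> rat by rewrite pnatr_eq0 -lt0n.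
have sumy p : (\sum_b y p b = q * \sum_b p.2 b + res_sum o p.1)%N.
  by rewrite /y /res_sum big_split /= big_distrr.
have qG p : lattice_res o p.1 -> q%:Z *: G p = yX p.
  move=> /forallP rp; apply/rowP => i; rewrite !mxE mulrC divzK //.
  have -> : \sum_b (y p b)%:Z * X b i =
     q%:Z * (\sum_b (p.2 b)%:Z * X b i) + \sum_b (p.1 b + o b)%N%:Z * X b i.
    rewrite mulr_sumr -big_split /=; apply: eq_bigr => b _; rewrite /y PoszD PoszM; ring.
  apply: rpredD; last exact: rp.
    exact: dvdz_mulr.
pose yQ p : 'rV[rat]_K.+1 := \row_b ((y p b)%:R / q%:R).
have GQ p : lattice_res o p.1 -> toQ (G p) = yQ p *m toQ X.
  move=> rp; apply: (scalerI q0); apply/rowP => i.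
  have /rowP/(_ i) := qG p rp; rewrite !mxE => /(congr1 (fun z : int => z%:~R : rat)).
  rewrite intrM -!pmulrn => ->; rewrite rmorph_sum mulr_sumr; apply: eq_bigr => b _.
  by rewrite !mxE /= intrM -!pmulrn mulrA mulrCA divff // mulr1.
have GC p : lattice_res o p.1 -> int_coords (G p) = yQ p.
  move=> rp; rewrite /int_coords (GQ p rp).
  have /row_free_inj inj := X_free; apply: inj.
  by rewrite mulmxKpV // submxMl.
have Ginj : {in A &, injective G}.
  move=> p p'; rewrite !inE => /andP[rp _] /andP[rp' _] GG.
  have yy b : y p b = y p' b.
    have : yQ p 0 b = yQ p' 0 b by rewrite -!GC // GG.
    rewrite !mxE => /(mulIf (_ : q%:R^-1 != 0)); rewrite invr_eq0 => /(_ q0)/eqP.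
    by rewrite eqr_nat => /eqP.
  have E b : (p.2 b = p'.2 b :> nat) /\ (p.1 b = p'.1 b :> nat).
    have := yy b; rewrite /y !addnA => /addIn E.
    have := congr1 (divn^~ q) E; have := congr1 (modn^~ q) E.
    rewrite /= ![(q * _)%N]mulnC !modnMDl !divnMDl // !divn_small // !modn_small //.
    by rewrite !addn0.
  move: E {yy GG rp rp'}; case: p p' => [r n] [r' n'] /= E.
  by congr (_, _); apply/ffunP => b; apply: val_inj; have [E1 E2] := E b.
have Gh p : p \in A -> G p 0 h = m%:Z.
  rewrite inE => /andP[rp /eqP sp]; have /rowP/(_ h) := qG p rp.
  rewrite !mxE (eq_bigr (fun b => (y p b)%:Z * N%:Z)) => [|b _]; last by rewrite Xh.
  rewrite -mulr_suml -(big_morph Posz PoszD (erefl _)) sumy -PoszM mulnC sp PoszM.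
  by apply: mulfI; rewrite -lt0n.
have Gho p : p \in A -> in_half_open o (G p).
  rewrite inE => /andP[rp _]; rewrite /in_half_open GC // GQ // submxMl /=.
  apply/forallP => b; rewrite mxE /y.
  case: (o b); last by rewrite divr_ge0.
  by rewrite divr_gt0 ?ltr0n // addn1 addnS.
have Gsurj x : in_half_open o x -> x 0 h = m%:Z -> exists2 p, p \in A & x = G p.
  move=> /andP[xX /forallP xo] xh.
  pose z := x *m Z.
  have zE : toQ z = q%:R *: int_coords x by rewrite toQ_M -qZ /int_coords [RHS]scalemxAr.
  have zb b : (z 0 b)%:~R = q%:R * int_coords x 0 b.
    by have /rowP/(_ b) := zE; rewrite !mxE.
  have qx : q%:Z *: x = z *m X.
    apply: toQ_inj; rewrite toQ_M zE -scalemxAl mulmxKpV //.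
    by apply/rowP => i; rewrite !mxE intrM -pmulrn.
  have zo b : (o b)%:Z <= z 0 b.
    have := xo b; have q0' : 0 < q%:R :> rat by rewrite ltr0n.
    case: (o b) => ob.
      have : 0 < z 0 b by rewrite -(ltr0z rat) zb mulr_gt0.
      by rewrite /=; lia.
    by rewrite -(ler0z rat) zb mulr_ge0 // ltW.
  pose a b := (absz (z 0%R b) - o b)%N.
  have za b : z 0 b = (a b + o b)%N%:Z.
    have := zo b; rewrite /a; case: (o b); lia.
  have suma : (N * \sum_b (a b + o b) = q * m)%N.
    have /rowP/(_ h) := qx; rewrite !mxE xh.
    rewrite (eq_bigr (fun b => (a b + o b)%N%:Z * N%:Z)) => [|b _]; last by rewrite Xh za.
    rewrite -mulr_suml -(big_morph Posz PoszD (erefl _)) -!PoszM => -[->].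
    by rewrite mulnC.
  have nm b : (a b %/ q < m.+1)%N.
    rewrite ltnS -(leq_pmul2r q_gt0) (leq_trans (leq_trunc_div _ _)) // mulnC -suma.
    by rewrite (leq_trans _ (leq_pmull _ N_gt0)) // (bigD1 b) //= -addnA leq_addr.
  have rq b : (a b %% q < q)%N by rewrite ltn_mod.
  pose p : T := ([ffun b => Ordinal (rq b)], [ffun b => Ordinal (nm b)]).
  have yE b : y p b = (a b + o b)%N.
    by rewrite /y /= !ffunE /= addnA mulnC -divn_eq.
  have yXE : yX p = z *m X.
    by apply/rowP => i; rewrite !mxE; apply: eq_bigr => b _; rewrite yE za.
  have rp : lattice_res o p.1.
    apply/forallP => i; have /rowP/(_ i) := qx; rewrite -yXE !mxE => E.
    have -> : \sum_b (p.1 b + o b)%N%:Z * X b i =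
       q%:Z * (x 0 i) - q%:Z * (\sum_b (p.2 b)%:Z * X b i).
      rewrite E mulr_sumr -sumrB; apply: eq_bigr => b _; rewrite /y !PoszD PoszM; ring.
    by rewrite -mulrBr dvdz_mulr.
  exists p.
    by rewrite inE rp -(sumy p) (eq_bigr _ (fun b _ => yE b)) suma eqxx.
  apply/rowP => i; apply: (mulfI (_ : q%:Z != 0)); first by rewrite -lt0n.
  by have /rowP/(_ i) := qG p rp; rewrite yXE -qx !mxE.
have -> : count (fun x => in_half_open o x && (x 0 h == m%:Z)) L = #|A|.
  rewrite -size_filter cardE -(size_map G); apply/perm_size/uniq_perm.
  - exact: filter_uniq.
  - rewrite map_inj_in_uniq ?enum_uniq // => p p'; rewrite !mem_enum; exact: Ginj.
  move=> x; rewrite mem_filter; apply/andP/mapP => [[/andP[xo /eqP xh] _]|[p]].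
    by have [p pA ->] := Gsurj x xo xh; exists p; rewrite ?mem_enum.
  rewrite mem_enum => pA ->; rewrite Gho // Gh // eqxx; split=> //.
  by apply: L_all; rewrite ?Gho ?Gh.
rewrite -sum1_card (eq_bigl (fun p : T => lattice_res o p.1 &&
  (N * (q * \sum_b p.2 b + res_sum o p.1) == q * m)%N)) => [|p]; last by rewrite inE.
rewrite -(pair_big_dep (lattice_res o) (fun (r : res) (n : {ffun 'I_K.+1 -> 'I_m.+1}) =>
  (N * (q * \sum_b n b + res_sum o r) == q * m)%N) (fun _ _ => 1%N)) /=.
by apply: eq_bigr => r _; rewrite sum1dep_card.
Qed.

Variable R : numFieldType.

Definition cell_term (z : int) : R :=
  if ((q * N)%N%:Z %| z)%Z then binR K (z %/ (q * N)%N%:Z)%Z%:~R else 0.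
Definition half_open_count o (m : int) : R :=
  \sum_(r : res | lattice_res o r) cell_term (q%:Z * m - (N * res_sum o r)%N%:Z).

(** A negative total [t] has no solutions [n], and [binR] agrees as long as [t > -(K + 1)]. The last
    hypothesis excludes [t = -(K + 1)], which a cell with all facets removed reaches at [m = 0]. *)
Lemma count_half_open o (m : nat) (L : seq 'rV[int]_D) : uniq L ->
  (forall x, in_half_open o x -> x 0 h = m%:Z -> x \in L) ->
  ((exists b, ~~ o b) \/ (0 < m)%N) ->
  (count (fun x => in_half_open o x && (x 0 h == m%:Z)) L)%:R = half_open_count o m.
Proof.
move=> L_uniq L_all om; rewrite (count_half_open_card L_uniq L_all) natr_sum.
apply: eq_bigr => r _; rewrite /cell_term.
have qN_gt0 : (0 < q * N)%N by rewrite muln_gt0 q_gt0.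
set z := _ - _.
have cond (n : {ffun 'I_K.+1 -> 'I_m.+1}) :
  (N * (q * \sum_b n b + res_sum o r) == q * m)%N =
  (z == (q * N)%N%:Z * (\sum_b n b)%N%:Z).
  by rewrite /z; apply/eqP/eqP; lia.
rewrite (eq_card (B := [set n : {ffun 'I_K.+1 -> 'I_m.+1} |
    z == (q * N)%N%:Z * (\sum_b n b)%N%:Z])) => [|n]; last by rewrite !inE cond.
case: ifP => [/dvdzP[t zt]|ndvd]; last first.
  rewrite eq_card0 // => n; rewrite inE; apply/negP => /eqP zE.
  by move: ndvd; rewrite zE dvdz_mulr.
have qN0 : (q * N)%N%:Z != 0 by rewrite -lt0n.
have -> : (z %/ (q * N)%N%:Z)%Z = t by rewrite zt mulzK.
have zE n : (z == (q * N)%N%:Z * n%:Z) = (n%:Z == t).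
  by rewrite zt mulrC (inj_eq (mulfI qN0)) eq_sym.
rewrite (eq_card (B := [set n : {ffun 'I_K.+1 -> 'I_m.+1} | (\sum_b n b)%N%:Z == t])) => [|n];
  last by rewrite !inE zE.
case: t zt {zE} => t zt.
  rewrite card_compositions ?binR_nat //.
  have : q%:Z * m%:Z >= (q * N)%N%:Z * t%:Z by rewrite /z in zt; lia.
  by rewrite -!PoszM lez_nat -mulnA leq_pmul2l // => /(leq_trans (leq_pmull t N_gt0)).
rewrite eq_card0 => [|n]; last by rewrite inE.
rewrite binR_negative //.
have S_le : (res_sum o r <= q * K.+1)%N.
  rewrite mulnC -[X in (X * q)%N](card_ord K.+1) -sum_nat_const; apply: leq_sum => b _.
  by have := ltn_ord (r b); case: (o b); rewrite ?addn1 ?addn0 // => /ltnW.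
have S_lt : (exists b, ~~ o b) -> (res_sum o r < q * K.+1)%N.
  move=> [b ob]; rewrite mulnC -[X in (X * q)%N](card_ord K.+1) -sum_nat_const.
  rewrite /res_sum (bigD1 b) //= [X in (_ < X)%N](bigD1 b) //= -addSn.
  apply: leq_add; first by rewrite (negbTE ob) addn0.
  by apply: leq_sum => b' _; have := ltn_ord (r b'); case: (o b'); rewrite ?addn1 ?addn0 // => /ltnW.
suff : (N * res_sum o r < N * (q * K.+1) + q * m)%N by rewrite /z in zt; nia.
case: om => [/S_lt lt|m_gt0].
  by rewrite ltn_addr // ltn_pmul2l.
apply: (@leq_ltn_trans (N * (q * K.+1))); first by rewrite leq_pmul2l.
by rewrite -addn1 leq_add2l muln_gt0 q_gt0.
Qed.

(** Complementing residues and facets sends [r b + o b] to [(q - 1 - r b) + (1 - o b) = q - (r b + o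
    b)], the opposite class modulo [q]. *)
Lemma lattice_res_rev o (r : res) :
  lattice_res (fun b => ~~ o b) [ffun b => rev_ord (r b)] = lattice_res o r.
Proof.
rewrite /lattice_res; apply: eq_forallb => i.
have -> : \sum_b (([ffun b => rev_ord (r b)] : res) b + ~~ o b)%N%:Z * X b i =
   q%:Z * (\sum_b X b i) - \sum_b (r b + o b)%N%:Z * X b i.
  rewrite mulr_sumr -sumrB; apply: eq_bigr => b _; rewrite ffunE /= -mulrBl; congr (_ * _).
  by have := ltn_ord (r b); case: (o b); lia.
by rewrite rpredBl // dvdz_mulr.
Qed.

Lemma res_sum_rev o (r : res) :
  (res_sum (fun b => ~~ o b) [ffun b => rev_ord (r b)] + res_sum o r = q * K.+1)%N.
Proof.
rewrite /res_sum -big_split /= mulnC -[X in (X * q)%N](card_ord K.+1) -sum_nat_const.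
apply: eq_bigr => b _; rewrite ffunE /=.
by have := ltn_ord (r b); case: (o b); lia.
Qed.

(** The complement turns the digit sum [S] into [q (K + 1) - S]; combined with the sign change of
    [m], it sends [t] to [- t - K - 1], the symmetry of [binR_reflect]. *)
Lemma half_open_count_reciprocity o m :
  half_open_count o (- m) = (-1) ^+ K * half_open_count (fun b => ~~ o b) m.
Proof.
pose f (r : res) : res := [ffun b => rev_ord (r b)].
have fK : involutive f by move=> r; apply/ffunP => b; rewrite !ffunE rev_ordK.
rewrite /half_open_count mulr_sumr [RHS](reindex_inj (inv_inj fK)) /=.
apply: eq_big => [r|r _]; first by rewrite lattice_res_rev.
have qN_gt0 : (0 < q * N)%N by rewrite muln_gt0 q_gt0.
have qN0 : (q * N)%N%:Z != 0 by rewrite -lt0n.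
set z1 := _ - _; set z2 := _ - _.
have E : z2 = - z1 - K.+1%:Z * (q * N)%N%:Z.
  rewrite /z1 /z2; have /(congr1 (muln N)) := res_sum_rev o r; rewrite -/(f r) mulnDr; lia.
rewrite /cell_term.
have -> : ((q * N)%N%:Z %| z2)%Z = ((q * N)%N%:Z %| z1)%Z.
  by rewrite E rpredBr ?rpredN // dvdz_mull.
case: ifP => [/dvdzP[t zt]|_]; last by rewrite mulr0.
rewrite E zt mulzK // -mulNr -mulrBl mulzK // intrB mulrNz binR_reflect.
by rewrite mulrA -expr2 sqrr_sign mul1r.
Qed.

Lemma half_open_count_quasipoly o :
  exists c : nat -> int -> R, [/\ forall i m, c i (m + N%:Z) = c i m,
    forall m : int, half_open_count o m = \sum_(i < K.+1) c i m * m%:~R ^+ i &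
    0 < c K 0].
Proof.
have qN_gt0 : (0 < q * N)%N by rewrite muln_gt0 q_gt0.
have qN0 : (q * N)%N%:Z != 0 by rewrite -lt0n.
have N0 : N%:R != 0 :> R by rewrite pnatr_eq0 -lt0n.
have q0 : q%:R != 0 :> R by rewrite pnatr_eq0 -lt0n.
(* On the class [r] one has [t = m / N - S / q]. The leading coefficient [1 / (K! N^K)] is the same
   positive number for all classes, so nothing cancels. *)
pose P (r : res) : {poly R} :=
  (K`!%:R)^-1 *: \prod_(i < K) (N%:R^-1 *: 'X + (i.+1%:R - (res_sum o r)%:R / q%:R)%:P).
pose dv (m : int) (r : res) := ((q * N)%N%:Z %| q%:Z * m - (N * res_sum o r)%N%:Z)%Z.
pose c i m := \sum_(r : res | lattice_res o r) (dv m r)%:R * (P r)`_i.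
have Psize r : (size (P r) <= K.+1)%N.
  apply: leq_trans (size_scale_leq _ _) _.
  by have [] := linear_prod_coef K N%:R^-1 (fun i => i.+1%:R - (res_sum o r)%:R / q%:R : R).
have PK r : (P r)`_K = (K`!%:R)^-1 * N%:R^-1 ^+ K.
  rewrite coefZ; congr (_ * _).
  by have [] := linear_prod_coef K N%:R^-1 (fun i => i.+1%:R - (res_sum o r)%:R / q%:R : R).
exists c; split=> [i m|m|].
- apply: eq_bigr => r _; congr (_ %:R * _); rewrite /dv.
  have -> : q%:Z * (m + N%:Z) - (N * res_sum o r)%N%:Z =
     q%:Z * m - (N * res_sum o r)%N%:Z + (q * N)%N%:Z by lia.
  by rewrite rpredDr.
- under [RHS]eq_bigr => i _ do rewrite mulr_suml.
  rewrite exchange_big /=; apply: eq_bigr => r _; rewrite /cell_term -/(dv m r).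
  case: (boolP (dv m r)) => [/dvdzP[t zt]|_]; last first.
    by rewrite big1 // => i _; rewrite !mul0r.
  under eq_bigr => i _ do rewrite mul1r.
  rewrite -horner_coef_wide // zt mulzK // /P hornerZ horner_prod /binR.
  congr (_ * _); apply: eq_bigr => i _; rewrite !hornerE.
  have -> : t%:~R = m%:~R / N%:R - (res_sum o r)%:R / q%:R :> R.
    have := congr1 (fun z : int => z%:~R : R) zt.
    rewrite intrB !intrM -!pmulrn !natrM => H.
    apply: (mulIf (mulf_neq0 q0 N0)); rewrite -H; field.
    by rewrite N0 q0.
  by rewrite addrAC mulrC.
have ge0 r : 0 <= (dv 0 r)%:R * (P r)`_K.
  by rewrite PK mulr_ge0 ?mulr_ge0 ?exprn_ge0 ?invr_ge0 ?ler0n.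
have q1 : (q.-1 < q)%N by rewrite prednK.
(* The class of the sum of the rows [X b] with [o b]: a lattice point whose height is a multiple of
   [N], so that this class contributes at [m = 0]. *)
pose r0 : res := [ffun b => if o b then Ordinal q1 else Ordinal q_gt0].
have r0E b : (r0 b + o b = q * o b)%N.
  by rewrite ffunE; case: (o b) => /=; rewrite ?muln1 ?muln0 ?addn1 ?prednK.
have r0_lat : lattice_res o r0.
  apply/forallP => i; apply: rpred_sum => b _; rewrite r0E PoszM -mulrA.
  exact: dvdz_mulr.
rewrite /c (bigD1 r0) //= ltr_pwDl ?sumr_ge0 //.
have -> : dv 0 r0.
  rewrite /dv mulr0 sub0r rpredN /res_sum (eq_bigr _ (fun b _ => r0E b)) -big_distrr /=.
  by rewrite mulnCA mulnA PoszM dvdz_mulr.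
by rewrite mul1r PK mulr_gt0 ?exprn_gt0 ?invr_gt0 ?ltr0n ?fact_gt0.
Qed.

End HalfOpenCount.

(** * Determinants of matrices of finite order *)

(** Sylvester's identity, from two block triangular factorizations of one matrix. *)
Lemma det_1subC (R : comPzRingType) m n (C : 'M[R]_(m, n)) (B : 'M[R]_(n, m)) :
  \det (1%:M - C *m B) = \det (1%:M - B *m C).
Proof.
have E1 : block_mx 1%:M C B 1%:M =
    block_mx 1%:M 0 B 1%:M *m block_mx 1%:M C 0 (1%:M - B *m C) :> 'M[R]_(m + n).
  by rewrite mulmx_block !(mul1mx, mulmx1, mul0mx, mulmx0, addr0, add0r) addrC subrK.
have E2 : block_mx 1%:M C B 1%:M =
    block_mx (1%:M - C *m B) C 0 1%:M *m block_mx 1%:M 0 B 1%:M :> 'M[R]_(m + n).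
  by rewrite mulmx_block !(mul1mx, mulmx1, mul0mx, mulmx0, addr0, add0r) subrK.
have := congr1 determinant E1; rewrite E2 !det_mulmx !det_lblock !det_ublock !det1.
by rewrite !mul1r !mulr1.
Qed.

(** A rank factorization [E = C R] of a projection satisfies [R C = 1], so [det_1subC] leaves the
    determinant of [-1] in size [\rank E]. *)
Lemma det_reflection (F : fieldType) n (E : 'M[F]_n) :
  E *m E = E -> \det (1%:M - 2%:R *: E) = (-1) ^+ \rank E.
Proof.
move=> EE; have CR := mulmx_base E.
have RC : row_base E *m col_base E = 1%:M.
  have /row_free_inj injR := row_base_free E.
  have /row_full_inj injC := col_base_full E.
  have : col_base E *m (row_base E *m col_base E) *m row_base E =
         col_base E *m 1%:M *m row_base E.
    by rewrite mulmx1 CR mulmxA CR -mulmxA CR EE.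
  by move/injR/injC.
rewrite -{1}CR scalemxAl det_1subC -scalemxAr RC.
have -> : 1%:M - 2%:R *: 1%:M = (-1)%:M :> 'M[F]_(\rank E).
  by rewrite scalemx1 -raddfB /= ; congr (_%:M); rewrite opprD addNKr.
by rewrite det_scalar.
Qed.

(* The form [S = sum_j (A^j)^T A^j] is definite and preserved by [A], so that
   [A^T S (A - 1) = - (A - 1)^T S]; now take determinants. *)
Lemma det_finite_order_no_fix (F : realFieldType) n (A : 'M[F]_n) N :
  (0 < N)%N -> A ^+ N = 1 -> A - 1 \in unitmx -> \det A = (-1) ^+ n.
Proof.
move=> N_gt0 AN A1; pose S := \sum_(j < N) (A ^+ j)^T *m A ^+ j.
have SA : A^T *m S *m A = S.
  pose f j := (A ^+ j)^T *m A ^+ j.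
  have -> : A^T *m S *m A = \sum_(j < N) f j.+1.
    rewrite mulmx_sumr mulmx_suml; apply: eq_bigr => j _.
    rewrite /f !mulmxA -trmx_mul -[A ^+ j *m A]/(A ^+ j * A) -exprSr -mulmxA.
    by rewrite -[A ^+ j *m A]/(A ^+ j * A) -exprSr.
  have fN : f N = f 0%N by rewrite /f AN expr0.
  rewrite /S -/f; case: (N) N_gt0 fN => // M _ fN.
  by rewrite big_ord_recr /= fN [RHS]big_ord_recl addrC.
have S_unit : S \in unitmx.
  rewrite -row_free_unit; apply: inj_row_free => v vS.
  have : (v *m S *m v^T) 0 0 = 0 by rewrite vS mul0mx mxE.
  pose w j := v *m (A ^+ j)^T.
  have -> : v *m S *m v^T = \sum_(j < N) w j *m (w j)^T.
    rewrite mulmx_sumr mulmx_suml; apply: eq_bigr => j _.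
    by rewrite /w trmx_mul trmxK !mulmxA.
  have nn (u : 'rV[F]_n) : 0 <= (u *m u^T) 0 0.
    by rewrite mxE; apply: sumr_ge0 => i _; rewrite mxE -expr2 sqr_ge0.
  rewrite summxE => /eqP; rewrite psumr_eq0; last by move=> j _; apply: nn.
  move=> /allP /(_ (Ordinal N_gt0)); rewrite mem_index_enum => /(_ isT) /=.
  rewrite /w expr0 trmx1 mulmx1 mxE psumr_eq0; last by move=> i _; rewrite mxE -expr2 sqr_ge0.
  move=> /allP H; apply/rowP => i; have := H i; rewrite mem_index_enum => /(_ isT) /=.
  by rewrite !mxE -expr2 sqrf_eq0 => /eqP.
have : A^T *m S *m (A - 1) = (-1) *: ((A - 1)^T *m S).
  by rewrite mulmxBr SA mulmx1 [(A - 1)^T]raddfB /= trmx1 scaleN1r mulmxBl mul1mx opprB.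
move/(congr1 determinant); rewrite detZ !det_mulmx !det_tr => H.
have S0 : \det S != 0 by rewrite -unitfE -unitmxE.
have A0 : \det (A - 1) != 0 by rewrite -unitfE -unitmxE.
by apply: (mulIf (mulf_neq0 A0 S0)); rewrite -H; ring.
Qed.

(** The average [E] of the powers of [A] projects onto the fixed space. Reversing the sign there
    gives [B = A (1 - 2 E)], which has finite order and no nonzero fixed vector; the reflection
    [1 - 2 E] accounts for the rank in the sign. *)
Lemma det_finite_order (F : realFieldType) n (A : 'M[F]_n) N :
  (0 < N)%N -> A ^+ N = 1 ->
  \det A = (-1) ^+ (n + \rank (\sum_(j < N) A ^+ j)%R).
Proof.
move=> N_gt0 AN; set T := \sum_(j < N) A ^+ j.
have N0 : N%:R != 0 :> F by rewrite pnatr_eq0 -lt0n.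
pose E := N%:R^-1 *: T.
have AT : A * T = T.
  rewrite /T mulr_sumr; case: (N) N_gt0 AN => // M _ AN.
  rewrite [RHS]big_ord_recl big_ord_recr /= -exprS AN expr0 addrC; congr (_ + _).
  by apply: eq_bigr => j _; rewrite -exprS.
have TA : T * A = T.
  rewrite -{2}AT /T mulr_sumr mulr_suml; apply: eq_bigr => j _.
  by rewrite -exprS exprSr.
have AE : A * E = E by rewrite -[LHS]/(A *m _) -scalemxAr [A *m T]AT.
have EA : E * A = E by rewrite -[LHS]/(_ *m A) -scalemxAl [T *m A]TA.
have fixE (v : 'rV[F]_n) : v *m A = v -> v *m E = v.
  move=> vA; have vAj j : v *m A ^+ j = v.
    by elim: j => [|j IH]; rewrite ?expr0 ?mulmx1 // exprS mulmxA vA.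
  rewrite -scalemxAr mulmx_sumr (eq_bigr (fun=> v)) => [|j _]; last exact: vAj.
  by rewrite sumr_const card_ord -scaler_nat scalerA mulVf // scale1r.
have EE : E *m E = E.
  apply/row_matrixP => i; rewrite row_mul; apply: fixE.
  by rewrite -row_mul [E *m A]EA.
have rkE : \rank E = \rank T by rewrite /E mxrank_scale_nz ?invr_eq0.
clearbody E; pose B := A - 2%:R *: E.
have BE : B = A *m (1%:M - 2%:R *: E).
  by rewrite mulmxBr mulmx1 -scalemxAr [A *m E]AE.
have B1 : B - 1 \in unitmx.
  rewrite -row_free_unit; apply: inj_row_free => v.
  rewrite mulmxBr mulmx1 => /eqP; rewrite subr_eq0 => /eqP vB.
  have vE : v *m E = 0.
    have : v *m B *m E = - (v *m E).
      rewrite -mulmxA mulmxBl [A *m E]AE -scalemxAl EE mulmxBr -scalemxAr scaler_nat mulr2n.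
      by rewrite opprD addNKr.
    rewrite vB => /eqP; rewrite -addr_eq0 -mulr2n -scaler_nat scaler_eq0 pnatr_eq0 /=.
    by move/eqP.
  have vA : v *m A = v by rewrite -[RHS]vB mulmxBr -scalemxAr vE scaler0 subr0.
  by rewrite -(fixE v vA).
(* The exponent is doubled because [B] acts as [-1] on the fixed space and [N] may be odd. *)
have BN : B ^+ (2 * N) = 1.
  rewrite exprM; have -> : B ^+ 2 = A ^+ 2.
    have EE' : E * E = E := EE.
    rewrite /B scaler_nat mulr2n expr2 mulrBr !mulrBl !mulrDr !mulrDl AE EA EE'.
    by rewrite opprB addrK subrK -expr2.
  by rewrite -exprM mulnC exprM AN expr1n.
have := det_finite_order_no_fix (_ : (0 < 2 * N)%N) BN B1; rewrite muln_gt0 => /(_ N_gt0).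
rewrite BE det_mulmx det_reflection // rkE => H.
by rewrite exprD -H -mulrA -expr2 sqrr_sign mulr1.
Qed.

(** * Lattice points of cones *)

Lemma pboolP (P : Prop) : reflect P (pbool P).
Proof. by rewrite /pbool; case: ClassicalEpsilon.excluded_middle_informative => ?; constructor. Qed.

Section ConeCount.
Variables (R : numFieldType) (n D N : nat) (W : 'M[int]_(n, D)) (h : 'I_D).
Hypotheses (N_gt0 : (0 < N)%N) (n_gt0 : (0 < n)%N) (Wh : forall i, W i h = N%:Z).
Notation WQ := (toQ W).
Implicit Types (B : {set 'I_n}) (z : 'rV[rat]_D) (x : 'rV[int]_D).

Lemma height_sum (l : 'rV[rat]_n) : (l *m WQ) 0 h = N%:R * \sum_i l 0 i.
Proof.
rewrite mxE mulr_sumr; apply: eq_bigr => i _.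
by rewrite mxE Wh mulrC.
Qed.

Lemma relation_sum0 (mu : 'rV[rat]_n) : mu *m WQ = 0 -> \sum_i mu 0 i = 0.
Proof.
move=> /rowP/(_ h); rewrite height_sum mxE => /eqP.
by rewrite mulf_eq0 pnatr_eq0 gtn_eqF //= => /eqP.
Qed.

(** The cell count needs rows indexed by ['I_K.+1], while [#|B|] equals [K.+1] only propositionally;
    the bijection [g] absorbs the transport. *)
Lemma basis_matrix B k : is_basis WQ B -> #|B| = k ->
  exists (X : 'M[int]_(k, D)) (g : 'I_k -> 'I_#|B|), [/\ row_free (toQ X),
    forall b, X b h = N%:Z, bijective g, (toQ X :=: gens WQ B)%MS &
    forall y b, (y *m pinvmx (toQ X)) 0 b = coords WQ B y 0 (g b)].
Proof.
move=> /andP[fB _] <-; exists (rowsub enum_val W), id.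
have E : toQ (rowsub enum_val W) = gens WQ B.
  by rewrite /gens /incl -rowsubE; apply/matrixP => i j; rewrite !mxE.
by rewrite E; split=> //; [move=> b; rewrite mxE Wh | exists id].
Qed.

Lemma half_open_quasipoly K B z : \rank WQ = K.+1 ->
  is_basis WQ B -> generic_point WQ z -> (z <= WQ)%MS -> 0 < z 0 h ->
  exists c : nat -> int -> R, [/\ forall i m, c i (m + N%:Z) = c i m, 0 < c K 0,
    forall (m : nat) (L : seq 'rV[int]_D), uniq L ->
      (forall x, in_cone WQ (toQ x) -> x 0 h = m%:Z -> x \in L) ->
      (count (fun x => [&& (toQ x <= WQ)%MS, half_open WQ z B (toQ x) & x 0 h == m%:Z]) L)%:R
       = \sum_(i < K.+1) c i m%:Z * m%:R ^+ i &
    forall (m : nat) (L : seq 'rV[int]_D), (0 < m)%N -> uniq L ->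
      (forall x, in_cone WQ (toQ x) -> x 0 h = m%:Z -> x \in L) ->
      (count (fun x => [&& (toQ x <= WQ)%MS, half_open WQ (- z) B (toQ x) & x 0 h == m%:Z]) L)%:R
       = (-1) ^+ K * \sum_(i < K.+1) c i (- m%:Z) * (- m%:R) ^+ i].
Proof.
move=> rW bB gz zW z_gt0.
have cB : #|B| = K.+1 by rewrite (card_basis bB) rW.
have [X [g [X_free Xh g_bij XB Xc]]] := basis_matrix bB cB.
have [q q_gt0 [Z qZ]] := common_denominator (pinvmx (toQ X)).
pose o b := ~~ (0 < coords WQ B z 0 (g b)).
have WX : (WQ :=: toQ X)%MS.
  apply/eqmxP; rewrite !XB; case/andP: bB => _ ->; exact: gens_sub.
have ho z' (o' : 'I_K.+1 -> bool) x : (forall b, o' b = ~~ (0 < coords WQ B z' 0 (g b))) ->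
    (toQ x <= WQ)%MS && half_open WQ z' B (toQ x) = in_half_open X o' x.
  move=> o'E; rewrite /in_half_open WX; congr (_ && _).
  apply/forallP/forallP => H b.
    by have := H (g b); rewrite o'E /int_coords Xc; case: (0 < _).
  have [g' gK g'K] := g_bij; have := H (g' b); rewrite o'E /int_coords Xc g'K.
  by case: (0 < coords WQ B z' 0 b).
have oN b : ~~ o b = ~~ (0 < coords WQ B (- z) 0 (g b)).
  have -> : coords WQ B (- z) 0 (g b) = - coords WQ B z 0 (g b).
    by rewrite /coords mulNmx mxE.
  rewrite /o negbK oppr_gt0 -leNgt le_eqVlt.
  by rewrite [0 == _]eq_sym (negbTE (gz B (g b) bB)).
have [c [cper cE cK]] := half_open_count_quasipoly N_gt0 q_gt0 X_free R o.
have cone_mem z' o' x : (forall b, o' b = ~~ (0 < coords WQ B z' 0 (g b))) ->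
    in_half_open X o' x -> in_cone WQ (toQ x).
  by move=> o'E; rewrite -(ho _ _ _ o'E) => /andP[xW]; exact: half_open_cone.
exists c; split=> // m L.
  move=> L_uniq L_all.
  rewrite (eq_count (a2 := fun x => in_half_open X o x && (x 0 h == m%:Z))); last first.
    by move=> x; rewrite -(ho z o x) //= andbA.
  rewrite (count_half_open N_gt0 q_gt0 X_free Xh qZ) // ?cE //.
    by move=> x xo; apply: L_all; apply: (cone_mem z o).
  (* If every facet were removed, [z] would have no positive coordinate, against its positive
     height. *)
  left; apply/existsP; apply: contraLR z_gt0 => /existsPn H.
  have zE : z = coords WQ B z *m gens WQ B by rewrite coordsK.
  rewrite -leNgt zE /gens mulmxA height_sum mulr_ge0_le0 ?ler0n //.
  apply: sumr_le0 => i _; case: (boolP (i \in B)) => iB; last by rewrite incl_out.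
  rewrite -(enum_rankK_in iB iB) inclE.
  have [g' gK g'K] := g_bij; have := H (g' (enum_rank_in iB i)).
  by rewrite negbK /o g'K -leNgt.
move=> m_gt0 L_uniq L_all.
rewrite (eq_count (a2 := fun x => in_half_open X (fun b => ~~ o b) x && (x 0 h == m%:Z))); last first.
  by move=> x; rewrite -(ho (- z) (fun b => ~~ o b) x) //= andbA.
rewrite (count_half_open N_gt0 q_gt0 X_free Xh qZ) //; last by right.
  have -> : \sum_(i < K.+1) c i (- m%:Z) * (- m%:R) ^+ i = half_open_count N q X R o (- m%:Z).
    by rewrite cE; apply: eq_bigr => i _; rewrite mulrNz.
  by rewrite (half_open_count_reciprocity N_gt0 q_gt0 X_free) mulrA -expr2 sqrr_sign mul1r.
by move=> x xo; apply: L_all; apply: (cone_mem (- z) _ _ oN).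
Qed.

Lemma sum_count (I : finType) (T : Type) (P : pred I) (p : I -> pred T) (L : seq T) :
  (\sum_(B | P B) count (p B) L = \sum_(x <- L) \sum_(B | P B) p B x)%N.
Proof. by rewrite exchange_big /=; apply: eq_bigr => B _; rewrite -big_mkcond sum1_count. Qed.

(** Fixing the height costs one dimension, hence the degree [K]. The weights [l] are returned
    because they give the direction in which the interior is tested. *)
Lemma cone_quasipoly (K := (\rank WQ).-1) :
  exists (l : 'rV[rat]_n) (c : nat -> int -> R), [/\ forall i, 0 < l 0 i,
    forall i m, c i (m + N%:Z) = c i m, 0 < c K 0,
    forall (m : nat) (L : seq 'rV[int]_D), uniq L ->
      (forall x, in_cone WQ (toQ x) -> x 0 h = m%:Z -> x \in L) ->
      (count (fun x => pbool (in_cone WQ (toQ x)) && (x 0 h == m%:Z)) L)%:R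
       = \sum_(i < K.+1) c i m%:Z * m%:R ^+ i &
    forall (m : nat) (L : seq 'rV[int]_D), (0 < m)%N -> uniq L ->
      (forall x, in_cone WQ (toQ x) -> x 0 h = m%:Z -> x \in L) ->
      (count (fun x => pbool (in_relint WQ (l *m WQ) (toQ x)) && (x 0 h == m%:Z)) L)%:R
       = (-1) ^+ K * \sum_(i < K.+1) c i (- m%:Z) * (- m%:R) ^+ i].
Proof.
have rW : \rank WQ = K.+1.
  rewrite /K prednK // lt0n mxrank_eq0; apply/eqP => /matrixP/(_ (Ordinal n_gt0) h).
  by rewrite !mxE Wh => /eqP; rewrite intr_eq0 => /eqP; lia.
have [cst gc] := generic_cost_exists WQ.
have [l l_gt0 gz] := generic_point_exists WQ.
set z := l *m WQ in gz *.
have zC : in_cone WQ z by exists l => // i; apply: ltW.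
have zW := in_cone_sub zC.
have z_gt0 : 0 < z 0 h.
  rewrite /z height_sum mulr_gt0 ?ltr0n // (bigD1 (Ordinal n_gt0)) //= ltr_pwDl //.
  by apply: sumr_ge0 => i _; apply: ltW.
have H B : exists c : nat -> int -> R, dual_feasible WQ cst B ->
   [/\ forall i m, c i (m + N%:Z) = c i m, 0 < c K 0,
    forall (m : nat) (L : seq 'rV[int]_D), uniq L ->
      (forall x, in_cone WQ (toQ x) -> x 0 h = m%:Z -> x \in L) ->
      (count (fun x => [&& (toQ x <= WQ)%MS, half_open WQ z B (toQ x) & x 0 h == m%:Z]) L)%:R
       = \sum_(i < K.+1) c i m%:Z * m%:R ^+ i &
    forall (m : nat) (L : seq 'rV[int]_D), (0 < m)%N -> uniq L ->
      (forall x, in_cone WQ (toQ x) -> x 0 h = m%:Z -> x \in L) ->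
      (count (fun x => [&& (toQ x <= WQ)%MS, half_open WQ (- z) B (toQ x) & x 0 h == m%:Z]) L)%:R
       = (-1) ^+ K * \sum_(i < K.+1) c i (- m%:Z) * (- m%:R) ^+ i].
  case: (boolP (dual_feasible WQ cst B)) => [/andP[bB _]|_]; last by exists (fun _ _ => 0).
  by have [c Hc] := half_open_quasipoly rW bB gz zW z_gt0; exists c.
have [c Hc] := fin_all_exists H.
have ifE (b : bool) : (if b then 1 else 0)%N = b by case: b.
have poly_sum (m : int) (t : R) :
    \sum_(i < K.+1) (\sum_(B | dual_feasible WQ cst B) c B i m) * t ^+ i =
    \sum_(B | dual_feasible WQ cst B) \sum_(i < K.+1) c B i m * t ^+ i.
  by rewrite exchange_big; apply: eq_bigr => i _; rewrite mulr_suml.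
exists l, (fun i m => \sum_(B | dual_feasible WQ cst B) c B i m); split=> //.
- by move=> i m; apply: eq_bigr => B /Hc[-> _ _ _].
- have [B dB _] := triangulation_cover relation_sum0 gc gz zC.
  rewrite (bigD1 B) //= ltr_pwDl //; first by have [] := Hc B dB.
  by apply: sumr_ge0 => B' /andP[/Hc[_ /ltW]].
- move=> m L L_uniq L_all; rewrite poly_sum.
  under [RHS]eq_bigr => B dB do (have [_ _ /(_ m L L_uniq L_all) <- _] := Hc B dB).
  rewrite -natr_sum sum_count -sum1_count big_mkcond; congr (_%:R).
  apply: eq_bigr => x _; have := cone_decomposition relation_sum0 gc gz zC (pboolP _).
  move=> /(_ (toQ x)) E; case: (x 0 h == m%:Z).
    by rewrite andbT ifE -E; apply: eq_bigr => B _; rewrite andbT.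
  by rewrite andbF big1 // => B _; rewrite !andbF.
- move=> m L m_gt0 L_uniq L_all; rewrite poly_sum mulr_sumr.
  under [RHS]eq_bigr => B dB do (have [_ _ _ /(_ m L m_gt0 L_uniq L_all) <-] := Hc B dB).
  rewrite -natr_sum sum_count -sum1_count big_mkcond; congr (_%:R).
  apply: eq_bigr => x _; have := relint_decomposition relation_sum0 gc gz zC (pboolP _).
  move=> /(_ (toQ x)) E; case: (x 0 h == m%:Z).
    by rewrite andbT ifE -E; apply: eq_bigr => B _; rewrite andbT.
  by rewrite andbF big1 // => B _; rewrite !andbF.
Qed.

End ConeCount.

(** * Cones fixed by a matrix of finite order *)

Section FixedCone.
Variables (n D N : nat) (V : 'M[rat]_(n, D)) (A : 'M[rat]_D).
Hypotheses (N_gt0 : (0 < N)%N) (AN : A ^+ N = 1).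
Hypothesis A_cone : forall y, in_cone V y -> in_cone V (y *m A).
Notation T := (\sum_(j < N) A ^+ j).

(* The interior of the cone when [V] spans the space, characterised without
   topology. *)
Definition pos_span (y : 'rV[rat]_D) : Prop :=
  exists2 b : 'rV[rat]_n, forall i, 0 < b 0 i & y = b *m V.

Lemma pos_span_cone y : pos_span y -> in_cone V y.
Proof. by case=> b b_gt0 ->; exists b => // i; apply: ltW. Qed.

Lemma pos_spanD y y' : pos_span y -> in_cone V y' -> pos_span (y + y').
Proof.
case=> [b b0 ->] [b' b'0 ->]; exists (b + b'); last by rewrite mulmxDl.
by move=> i; rewrite mxE ltr_pwDl.
Qed.

Lemma pos_spanZ a y : 0 < a -> pos_span y -> pos_span (a *: y).
Proof.
move=> a0 [b b0 ->]; exists (a *: b); last by rewrite scalemxAl.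
by move=> i; rewrite mxE mulr_gt0.
Qed.

Lemma pos_span_sub y z : pos_span y -> in_cone V z ->
  exists2 s, 0 < s & in_cone V (y - s *: z).
Proof.
case=> [b b_gt0 ->] [l l_ge0 ->].
have [s s_gt0 sl] := small_scale (l 0) b_gt0.
exists s => //; exists (b - s *: l); last by rewrite mulmxBl scalemxAl.
move=> i; rewrite !mxE subr_ge0 (le_trans _ (ltW (sl i))) //.
by rewrite ler_wpM2l ?ler_norm // ltW.
Qed.

Lemma orbit_sum_fix : T *m A = T.
Proof.
have -> : T *m A = \sum_(j < N) A ^+ j.+1.
  by rewrite mulmx_suml; apply: eq_bigr => j _; rewrite exprSr.
case: (N) N_gt0 AN => // M _ E.
by rewrite big_ord_recr /= E [RHS]big_ord_recl expr0 addrC.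
Qed.

Lemma fix_orbit_sum (y : 'rV[rat]_D) : y *m A = y -> y *m T = N%:R *: y.
Proof.
move=> yA; have yAj j : y *m A ^+ j = y.
  by elim: j => [|j IH]; rewrite ?expr0 ?mulmx1 // exprS mulmxA yA.
rewrite mulmx_sumr (eq_bigr (fun=> y)) => [|j _]; last exact: yAj.
by rewrite sumr_const card_ord scaler_nat.
Qed.

Lemma fix_average (y : 'rV[rat]_D) : y *m A = y -> y = N%:R^-1 *: y *m T.
Proof.
move=> /fix_orbit_sum yT; rewrite -scalemxAl yT scalerA mulVf ?scale1r //.
by rewrite pnatr_eq0 -lt0n.
Qed.

Lemma cone_power y j : in_cone V y -> in_cone V (y *m A ^+ j).
Proof.
move=> yV; elim: j => [|j IH]; first by rewrite expr0 mulmx1.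
by rewrite exprSr mulmxA; apply: A_cone.
Qed.

Lemma cone_orbit_sum y : in_cone V y -> exists2 y', in_cone V y' & y *m T = y + y'.
Proof.
move=> yV; case: (N) N_gt0 => // M _; rewrite big_ord_recl expr0 mulmxDr mulmx1.
exists (y *m \sum_(i < M) A ^+ lift ord0 i) => //.
rewrite mulmx_sumr; elim/big_rec: _ => [|i x _ xV].
  by exists 0 => [i|]; rewrite ?mul0mx ?mxE.
by apply: in_coneD => //; apply: cone_power.
Qed.

(* The orbit sum of the generators is an [A]-invariant positive combination, so
   [y - s o T] stays in the cone under [A]. *)
Lemma pos_span_act y : pos_span y -> pos_span (y *m A).
Proof.
pose o := (const_mx 1 : 'rV_n) *m V; have oP : pos_span o by exists (const_mx 1) => // i; rewrite mxE.
have [o' o'V oT] := cone_orbit_sum (pos_span_cone oP).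
have oTP : pos_span (o *m T) by rewrite oT; apply: pos_spanD.
move=> yP; have [s s_gt0 /A_cone] := pos_span_sub yP (pos_span_cone oTP).
rewrite mulmxBl -scalemxAl -mulmxA orbit_sum_fix => yC.
rewrite -(subrK (s *: (o *m T)) (y *m A)) addrC; apply: pos_spanD => //.
exact: pos_spanZ.
Qed.

(** A fixed point equals the average of its orbit, so averaging an expression in [V] gives one in
    [V *m T]; conversely an orbit sum is fixed and stays in the invariant cone. *)
Lemma fixed_coneP y : in_cone (V *m T) y <-> in_cone V y /\ y *m A = y.
Proof.
split=> [[l l_ge0 ->]|[[l l_ge0 yE] yA]].
  rewrite -!mulmxA orbit_sum_fix; split=> //.
  have lV : in_cone V (l *m V) by exists l.
  have [y' y'V] := cone_orbit_sum lV; rewrite -mulmxA => ->; exact: in_coneD.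
exists (N%:R^-1 *: l) => [i|]; first by rewrite mxE mulr_ge0 ?invr_ge0.
by rewrite mulmxA -scalemxAl -yE -fix_average.
Qed.

(** The direction [l *m V *m T] is itself a strictly positive combination of [V], so adding a
    multiple of it to a cone point lands in [pos_span]. Conversely, averaging a strictly positive
    expression of [y] leaves room to subtract a small multiple of [l]. *)
Lemma fixed_relintP (l : 'rV[rat]_n) y : (forall i, 0 < l 0 i) ->
  in_relint (V *m T) (l *m (V *m T)) y <-> pos_span y /\ y *m A = y.
Proof.
move=> l_gt0; have lP : pos_span (l *m V) by exists l.
have [l' l'V lT] := cone_orbit_sum (pos_span_cone lP).
have lTP : pos_span (l *m V *m T) by rewrite lT; apply: pos_spanD.
rewrite mulmxA; split=> [[s s_gt0 /fixed_coneP[yV yA]]|[[b b_gt0 yE] yA]].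
  split.
    rewrite -(subrK (s *: (l *m V *m T)) y) addrC; apply: pos_spanD => //.
    exact: pos_spanZ.
  have zA : l *m V *m T *m A = l *m V *m T by rewrite -mulmxA orbit_sum_fix.
  by move: yA; rewrite mulmxBl -scalemxAl zA => /addIr.
have bP i : 0 < (N%:R^-1 *: b) 0 i by rewrite mxE mulr_gt0 ?invr_gt0 ?ltr0n.
have [s s_gt0 sl] := small_scale (l 0) bP; exists s => //.
exists (N%:R^-1 *: b - s *: l) => [i|].
  rewrite mxE [X in _ + X]mxE [X in _ + - X]mxE subr_ge0 (le_trans _ (ltW (sl i))) //.
  by rewrite ler_wpM2l ?ler_norm // ltW.
by rewrite mulmxBl -!scalemxAl !mulmxA -yE scalemxAl -fix_average.
Qed.

End FixedCone.

(** * The polytope and its cone *)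

Lemma toQ_exp n (A : 'M[int]_n) j : toQ (A ^+ j) = toQ A ^+ j.
Proof.
elim: j => [|j IH]; first by rewrite !expr0 map_mx1.
by rewrite !exprS -IH; exact: toQ_M.
Qed.

Lemma tr_exp (R : comPzRingType) n (A : 'M[R]_n) j : (A ^+ j)^T = A^T ^+ j.
Proof.
elim: j => [|j IH]; first by rewrite !expr0 trmx1.
by rewrite exprSr exprS -IH; exact: trmx_mul.
Qed.

Lemma mem_box n B (x : 'cV[int]_n) : (x \in box n B) = [forall i, (absz (x i 0%R) <= B)%N].
Proof.
apply/imageP/forallP => [[f _ ->] i|H].
  by rewrite mxE; case: (f i) => k /=; rewrite -addnn; lia.
have lt i : (absz (x i 0 + B%:Z)%R < B.*2.+1)%N by rewrite -addnn; have := H i; lia.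
exists [ffun i => Ordinal (lt i)] => //.
by apply/colP => i; rewrite mxE ffunE /=; have := H i; lia.
Qed.

Lemma box_uniq n B : uniq (box n B).
Proof.
rewrite map_inj_uniq ?enum_uniq // => f f' /colP ff'; apply/ffunP => i; apply: val_inj.
by have := ff' i; rewrite !mxE => /addIr[].
Qed.

Lemma leq_count_inj (T : eqType) (P Q : pred T) (L L' : seq T) (f : T -> T) :
  uniq L -> injective f -> (forall x, P x -> Q (f x) && (f x \in L')) ->
  (count P L <= count Q L')%N.
Proof.
move=> L_uniq f_inj PQ; rewrite -!size_filter -(size_map f).
apply: uniq_leq_size; first by rewrite map_inj_uniq ?filter_uniq.
by move=> _ /mapP[x + ->]; rewrite !mem_filter => /andP[/PQ].
Qed.

Section Polytope.
Variables (d : nat) (V : seq 'cV[int]_(d + 1)).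
Hypotheses (V_neq0 : V != [::]) (V_height : forall v, v \in V -> v (lastc d) 0 = 1).
Notation h := (lastc d).

Definition gen_mx : 'M[int]_(size V, d + 1) := \matrix_(i, j) nth 0 V i j 0.
Notation VQ := (toQ gen_mx).

Lemma size_gt0 : (0 < size V)%N.
Proof. by case: (V) V_neq0. Qed.

Lemma gen_mx_height i : gen_mx i h = 1%N%:Z.
Proof. by rewrite mxE V_height // mem_nth. Qed.

Lemma in_hullP k y : 0 <= k -> in_hull k V y <-> in_cone VQ y^T /\ y h 0 = k.
Proof.
move=> k_ge0; split=> [[lam [lam_ge0 [lam1 yE]]]|[[l l_ge0 yl] yk]].
  have yV : y^T = (\row_i (k * lam i)) *m VQ.
    apply/rowP => j; rewrite yE !mxE summxE; apply: eq_bigr => i _.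
    by rewrite !mxE.
  split; first by exists (\row_i (k * lam i)) => // i; rewrite mxE mulr_ge0.
  have -> : y h 0 = y^T 0 h by rewrite mxE.
  rewrite yV (height_sum (N := 1) gen_mx_height) mul1r.
  by under eq_bigr => i _ do rewrite mxE; rewrite -mulr_sumr lam1 mulr1.
have lk : \sum_i l 0 i = k.
  by rewrite -yk -[LHS]mul1r -(height_sum (N := 1) gen_mx_height) -yl mxE.
have yE : y = \sum_i l 0 i *: ratmx (nth 0 V i).
  apply/colP => j; have /rowP/(_ j) := yl; rewrite !mxE summxE => ->.
  by apply: eq_bigr => i _; rewrite !mxE.
have [k0|k0] := eqVneq k 0.
  (* For the dilate by 0 the weights must still sum to 1, so one vertex takes all of it. *)
  exists (fun i => (i == Ordinal size_gt0)%:R); split; first by move=> i; rewrite ler0n.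
  split; first by rewrite (bigD1 (Ordinal size_gt0)) //= big1 ?addr0 // => i /negbTE ->.
  rewrite yE; apply: eq_bigr => i _; rewrite k0 mul0r; congr (_ *: _).
  move/eqP: lk; rewrite k0 psumr_eq0 // => /allP/(_ i).
  by rewrite mem_index_enum => /(_ isT)/eqP.
exists (fun i => l 0 i / k); split; first by move=> i; rewrite divr_ge0.
split; first by rewrite -mulr_suml lk divff.
by rewrite yE; apply: eq_bigr => i _; rewrite mulrC divfK.
Qed.

Lemma in_mPP m x : in_mP V m x <-> in_cone VQ (toQ x^T) /\ x h 0 = m%:Z.
Proof.
rewrite /in_mP in_hullP ?ler0n // map_trmx [ratmx x h 0]mxE.
have -> : m%:R = m%:Z%:~R :> rat by [].
by split=> -[H E]; split=> //; [move/eqP: E; rewrite eqr_int => /eqP|rewrite E].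
Qed.

Lemma cone_box m (x : 'cV[int]_(d + 1)) :
  in_cone VQ (toQ x^T) -> x h 0 = m%:Z -> x \in box (d + 1) (m * vbound V).
Proof.
move=> [l l_ge0 xl] xm; rewrite mem_box; apply/forallP => j.
have lm : \sum_i l 0 i = m%:R.
  by rewrite -[LHS]mul1r -(height_sum (N := 1) gen_mx_height) -xl !mxE xm.
have xj : (x j 0)%:~R = \sum_i l 0 i * (nth 0 V i j 0)%:~R :> rat.
  by have /rowP/(_ j) := xl; rewrite !mxE => ->; apply: eq_bigr => i _; rewrite !mxE.
have bnd (i : 'I_(size V)) : `|(nth 0 V i j 0)%:~R : rat| <= (vbound V)%:R.
  rewrite -intr_norm -natr_absz ler_nat.
  rewrite /vbound; apply: leq_trans (leq_bigmax_seq _ (mem_nth 0 (ltn_ord i)) isT).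
  exact: (@leq_bigmax _ (fun j => absz (nth 0 V i j ord0))).
rewrite -(ler_nat rat) natr_absz intr_norm xj (le_trans (ler_norm_sum _ _ _)) //.
rewrite natrM -lm mulr_suml; apply: ler_sum => i _.
by rewrite normrM ger0_norm // ler_wpM2l.
Qed.

Hypothesis V_full : full_dim V.

Lemma gen_mx_full : row_full VQ.
Proof.
rewrite /row_full -mxrank_tr -[X in _ == X]V_full; apply/eqP; congr (\rank _).
by apply/matrixP => i j; rewrite !mxE.
Qed.

Lemma in_int_mPP m x : (0 < m)%N ->
  in_int_mP V m x <-> pos_span VQ (toQ x^T) /\ x h 0 = m%:Z.
Proof.
move=> m_gt0.
pose s : rat := m%:R / (size V)%:R.
have s_gt0 : 0 < s by rewrite divr_gt0 ?ltr0n ?size_gt0.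
pose o : 'cV[rat]_(d + 1) := \sum_(i < size V) s *: ratmx (nth 0 V i).
have oE : o^T = const_mx s *m VQ.
  by apply/rowP => j; rewrite !mxE summxE; apply: eq_bigr => i _; rewrite !mxE.
have oh : o h 0 = m%:R.
  have -> : o h 0 = o^T 0 h by rewrite mxE.
  rewrite oE (height_sum (N := 1) gen_mx_height) mul1r.
  under eq_bigr => i _ do rewrite mxE.
  by rewrite sumr_const card_ord -[LHS]mulr_natr /s divfK // pnatr_eq0 -lt0n size_gt0.
split=> [[xP [e [e_gt0 eP]]]|[[b b_gt0 xb] xm]].
  have [_ xm] := (in_mPP m x).1 xP; split=> //.
  (* The segment from the scaled barycenter [o] can be prolonged slightly past [x] inside [mP];
     solving for [x] gives an expression containing the positive weights of [o]. *)
  have [t t_gt0 te] := small_scale (fun i => (ratmx x - o) i 0) (fun _ : 'I_(d + 1) => e_gt0).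
  have : in_hull m%:R V (ratmx x + t *: (ratmx x - o)).
    apply: eP => [|i]; last by rewrite mxE normrM gtr0_norm // ltW.
    by rewrite !mxE oh xm subrr mulr0.
  move=> /(in_hullP _ (ler0n _ _))[[l l_ge0 xl] _].
  have t1 : 0 < 1 + t by rewrite addr_gt0.
  exists ((1 + t)^-1 *: (l + t *: const_mx s)) => [i|].
    by rewrite !mxE mulr_gt0 ?invr_gt0 // ltr_wpDl // mulr_gt0.
  rewrite -scalemxAl mulmxDl -scalemxAl -oE -xl.
  apply: (scalerI (lt0r_neq0 t1)); rewrite scalerA divff ?lt0r_neq0 // scale1r.
  by apply/rowP => j; rewrite !mxE; ring.
split.
  by apply/in_mPP; split=> //; exists b => // i; apply: ltW.
(* Since the vertices span, [w^T *m P] writes a perturbation [w] in terms of them; [e] keeps its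
   coefficients below those of [b]. *)
pose P := pinvmx VQ.
have [e e_gt0 eb] := small_scale (fun i => \sum_k `|P k i|) b_gt0.
exists e; split=> // w wh we; apply/in_hullP; rewrite ?ler0n //; split; last first.
  by rewrite mxE wh addr0 mxE xm.
exists (b + w^T *m P) => [i|]; last first.
  rewrite mulmxDl -xb mulmxKpV ?submx_full ?gen_mx_full //.
  by apply/rowP => j; rewrite !mxE.
rewrite mxE -[X in _ + X]opprK subr_ge0 (le_trans _ (ltW (eb i))) //.
rewrite (le_trans (ler_norm _)) // normrN mxE (le_trans (ler_norm_sum _ _ _)) //.
apply: (@le_trans _ _ (e * \sum_k `|P k i|)).
  rewrite mulr_sumr; apply: ler_sum => k _.
  by rewrite normrM mxE ler_wpM2r.
by rewrite ler_wpM2l ?ler_norm ?ltW.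
Qed.

End Polytope.

Lemma det_height_preserving d (P : 'M[int]_(d + 1)) :
  (forall x : 'cV[int]_(d + 1), (P *m x) (lastc d) 0 = x (lastc d) 0) ->
  \det P = \det (ulsubmx P).
Proof.
move=> Ph; have Plast j : P (lastc d) j = (lastc d == j)%:R.
  by have := Ph (delta_mx j 0); rewrite -colE !mxE eqxx andbT.
have dl0 : dlsubmx P = 0.
  apply/matrixP => i j; rewrite !mxE ord1 Plast.
  by rewrite -val_eqE /= addn0 gtn_eqF.
have dr1 : drsubmx P = 1%:M.
  by apply/matrixP => i j; rewrite !mxE !ord1 Plast -[rshift d 0]/(lastc d) !eqxx.
by rewrite -{1}(submxK P) dl0 dr1 det_ublock det1 mulr1.
Qed.

Lemma toQ_sum n (I : finType) (F : I -> 'M[int]_n) : toQ (\sum_i F i) = \sum_i toQ (F i).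
Proof.
apply/matrixP => i j; rewrite mxE !summxE rmorph_sum; apply: eq_bigr => k _.
by rewrite mxE.
Qed.

(** * Fixed lattice points of a single group element *)

Section FixedPoints.
Variables (d : nat) (V : seq 'cV[int]_(d + 1)).
Hypotheses (V_neq0 : V != [::]) (V_height : forall v, v \in V -> v (lastc d) 0 = 1).
Hypothesis V_full : full_dim V.
Notation h := (lastc d).
Notation VQ := (toQ (gen_mx V)).
Variables (N : nat) (P : 'M[int]_(d + 1)).
Hypotheses (N_gt0 : (0 < N)%N) (PN : P ^+ N = 1).
Hypothesis Ph : forall x : 'cV[int]_(d + 1), (P *m x) h 0 = x h 0.
Notation A := (toQ P)^T.
Hypothesis A_cone : forall y, in_cone VQ y -> in_cone VQ (y *m A).

Lemma AN : A ^+ N = 1.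
Proof. by rewrite -tr_exp -toQ_exp PN map_mx1 trmx1. Qed.

Lemma toQ_act (x : 'cV[int]_(d + 1)) : toQ (P *m x)^T = toQ x^T *m A.
Proof. by rewrite -!map_trmx toQ_M trmx_mul. Qed.

Lemma fixedP (x : 'cV[int]_(d + 1)) : toQ x^T *m A = toQ x^T <-> P *m x = x.
Proof.
rewrite -toQ_act; split=> [/toQ_inj/trmx_inj //|-> //].
Qed.

Lemma in_mP_act m x : in_mP V m x -> in_mP V m (P *m x).
Proof.
move=> /(in_mPP V_neq0 V_height)[xC xm]; apply/(in_mPP V_neq0 V_height).
by rewrite Ph toQ_act; split=> //; apply: A_cone.
Qed.

Lemma in_int_mP_act m x : (0 < m)%N -> in_int_mP V m x -> in_int_mP V m (P *m x).
Proof.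
move=> m_gt0 /(in_int_mPP V_neq0 V_height V_full _ m_gt0)[xC xm].
apply/(in_int_mPP V_neq0 V_height V_full _ m_gt0).
by rewrite Ph toQ_act; split=> //; apply: (pos_span_act N_gt0 AN A_cone).
Qed.

Definition orbit_gens : 'M[int]_(size V, d + 1) := gen_mx V *m \sum_(j < N) P^T ^+ j.

Lemma toQ_orbit_gens : toQ orbit_gens = VQ *m \sum_(j < N) A ^+ j.
Proof.
rewrite toQ_M toQ_sum; congr (_ *m _); apply: eq_bigr => j _.
by rewrite toQ_exp map_trmx.
Qed.

Lemma orbit_gens_height i : orbit_gens i h = N%:Z.
Proof.
have rowh (y : 'rV[int]_(d + 1)) j : (y *m P^T ^+ j) 0 h = y 0 h.
  elim: j y => [|j IH] y; first by rewrite expr0 mulmx1.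
  rewrite exprS mulmxA IH.
  have -> : y *m P^T = (P *m y^T)^T by rewrite trmx_mul trmxK.
  by rewrite mxE Ph mxE.
have -> : orbit_gens i h = (row i orbit_gens) 0 h by rewrite [RHS]mxE.
rewrite row_mul mulmx_sumr summxE (eq_bigr (fun=> 1)) => [|j _].
  by rewrite sumr_const card_ord natz.
by rewrite rowh mxE gen_mx_height.
Qed.

Lemma rank_orbit_gens : \rank (toQ orbit_gens) = \rank (\sum_(j < N) A ^+ j)%R.
Proof. by rewrite toQ_orbit_gens (eqmxMfull _ (gen_mx_full V_full)). Qed.

Lemma det_sign : \det (ulsubmx P) = (-1) ^+ (d + (\rank (toQ orbit_gens)).-1).
Proof.
have r_gt0 : (0 < \rank (toQ orbit_gens))%N.
  rewrite lt0n mxrank_eq0; apply/eqP => /matrixP/(_ (Ordinal (size_gt0 V_neq0)) h).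
  by rewrite mxE orbit_gens_height mxE => /eqP; rewrite intr_eq0 => /eqP; lia.
have := det_finite_order N_gt0 AN; rewrite -rank_orbit_gens det_tr det_map_mx.
rewrite det_height_preserving // addnAC -[X in (d + X + 1)%N](prednK r_gt0).
rewrite addn1 addnS !exprS !mulN1r opprK => /eqP.
have -> : (-1) ^+ (d + (\rank (toQ orbit_gens)).-1) =
  ((-1) ^+ (d + (\rank (toQ orbit_gens)).-1) : int)%:~R :> rat.
  by rewrite rmorphXn /= rmorphN1.
by rewrite eqr_int => /eqP.
Qed.

Lemma fixed_quasipoly (gT : finGroupType) (rho : gT -> 'M[int]_(d + 1)) (g : gT) :
  rho g = P ->
  exists c : nat -> int -> algC, [/\ forall i m, c i (m + N%:Z) = c i m,
    forall m : nat, \sum_(i < d.+1) c i m%:Z * m%:R ^+ i = (chiP rho V m g)%:R,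
    forall m : nat, (0 < m)%N ->
      (-1) ^+ d * \sum_(i < d.+1) c i (- m%:Z) * (- m%:R) ^+ i =
      (chiIntP rho V m g)%:R * (detrho rho g)%:~R &
    P = 1 -> 0 < c d 0].
Proof.
move=> rhoP.
have [l [c [l_gt0 cper cK cP cI]]] :=
  cone_quasipoly algC N_gt0 (size_gt0 V_neq0) orbit_gens_height.
set K := (\rank _).-1 in cK cP cI.
have Kd : (K < d.+1)%N.
  by rewrite /K; have := rank_leq_col (toQ orbit_gens); lia.
(* An element with a small fixed space has degree [K < d]; its coefficients are padded with zeros up
   to degree [d]. *)
pose c' i m := if (i < K.+1)%N then c i m else 0.
have c'E (m : int) (t : algC) :
    \sum_(i < d.+1) c' i m * t ^+ i = \sum_(i < K.+1) c i m * t ^+ i.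
  rewrite (big_ord_widen d.+1 (fun i => c i m * t ^+ i) Kd) [RHS]big_mkcond.
  by apply: eq_bigr => i _; rewrite /c'; case: ifP; rewrite ?mul0r.
pose L m := [seq x^T | x <- box (d + 1) (m * vbound V)].
have L_uniq m : uniq (L m) by rewrite map_inj_uniq ?box_uniq //; exact: trmx_inj.
have coneP y : in_cone (toQ orbit_gens) y <-> in_cone VQ y /\ y *m A = y.
  by rewrite toQ_orbit_gens; exact: (fixed_coneP N_gt0 AN A_cone).
have relintP y : in_relint (toQ orbit_gens) (l *m toQ orbit_gens) y <->
    pos_span VQ y /\ y *m A = y.
  by rewrite toQ_orbit_gens; exact: (fixed_relintP N_gt0 AN A_cone).
have L_all m x : in_cone (toQ orbit_gens) (toQ x) -> x 0 h = m%:Z -> x \in L m.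
  move=> /coneP[xC _] xm; rewrite -(trmxK x); apply: map_f.
  by apply: (cone_box V_height); rewrite ?trmxK // mxE.
exists c'; split=> [i m|m|m m_gt0|P1].
- by rewrite /c' cper.
- rewrite c'E -(cP m (L m)) //; last exact: L_all.
  rewrite count_map /chiP; congr (_%:R); apply: eq_count => x /=; rewrite rhoP mxE.
  apply/andP/andP => -[/pboolP H1 /eqP H2]; (split; [apply/pboolP | apply/eqP]).
  + by apply/(in_mPP V_neq0 V_height); move: H1 => /coneP[].
  + by move: H1 => /coneP[_ H]; exact: (fixedP x).1 H.
  + by move: H1 => /(in_mPP V_neq0 V_height)[H _]; apply/coneP; split=> //; apply/fixedP.
  + by move: H1 => /(in_mPP V_neq0 V_height)[].
- have S1 (k : nat) : (-1) ^+ k * (-1) ^+ k = 1 :> algC by rewrite -expr2 sqrr_sign.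
  have -> : chiIntP rho V m g = count (fun x : 'rV[int]_(d + 1) =>
     pbool (in_relint (toQ orbit_gens) (l *m toQ orbit_gens) (toQ x)) && (x 0 h == m%:Z)) (L m).
    rewrite count_map /chiIntP; apply: eq_count => x /=; rewrite rhoP mxE.
    apply/andP/andP => -[/pboolP H1 /eqP H2]; (split; [apply/pboolP | apply/eqP]).
    + move: H1 => /(in_int_mPP V_neq0 V_height V_full _ m_gt0)[H _].
      by apply/relintP; split=> //; apply/fixedP.
    + by move: H1 => /(in_int_mPP V_neq0 V_height V_full _ m_gt0)[].
    + apply/(in_int_mPP V_neq0 V_height V_full _ m_gt0).
      by move: H1 => /relintP[].
    + by move: H1 => /relintP[_ H]; exact: (fixedP x).1 H.
  rewrite (cI m) //; last exact: L_all.
  rewrite c'E /detrho rhoP det_sign -/K rmorphXn /= rmorphN1 exprD.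
  set X := \sum_(i < _) _.
  by rewrite [X in _ = _ * X]mulrC mulrACA S1 mul1r mulrC.
have -> : d = K.
  rewrite /K rank_orbit_gens P1 map_mx1 trmx1 (eq_bigr (fun=> 1)) => [|j _]; last by rewrite expr1n.
  rewrite sumr_const card_ord -scaler_nat mxrank_scale_nz ?mxrank1 ?addn1 //.
  by rewrite pnatr_eq0 -lt0n.
by rewrite /c' ltnSn.
Qed.

End FixedPoints.

(** * Assembling the class functions *)

Theorem theorem5p6 (gT : finGroupType) (G : {group gT}) (d : nat)
    (rho : gT -> 'M[int]_(d + 1)) (V : seq 'cV[int]_(d + 1)) :
  (* rho is a linear action of G on M' = Z^(d+1) *)
  rho 1%g = 1%:M ->
  {in G &, forall g h, rho (g * h)%g = rho g *m rho h} ->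
  (* the projection M' -> Z onto the last factor is G-invariant *)
  {in G, forall g (x : 'cV[int]_(d + 1)), (rho g *m x) (lastc d) 0 = x (lastc d) 0} ->
  (* P = conv(V) is a lattice polytope in M_R x {1} *)
  V != [::] ->
  (forall v, v \in V -> v (lastc d) 0 = 1) ->
  (* P is d-dimensional *)
  full_dim V ->
  (* P is G-invariant *)
  {in G, forall g (y : 'cV[rat]_(d + 1)),
     in_hull 1 V y <-> in_hull 1 V (ratmx (rho g) *m y)} ->
  exists L : 'I_d.+1 -> int -> 'CF(G),
    (* each L_i is periodic with period dividing exp(G) *)
    (forall i m, L i (m + (exponent G)%:Z) = L i m) /\
    (* L(m) = chi_{mP} for m >= 0 *)
    (forall m : nat, {in G, forall g, qeval L m%:Z g = (chiP rho V m g)%:R}) /\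
    (* degree exactly d *)
    (exists m, L ord_max m != 0) /\
    (* L(0) is the trivial character *)
    {in G, forall g, qeval L 0 g = 1} /\
    (* reciprocity *)
    (forall m : nat, (0 < m)%N ->
       {in G, forall g, (-1) ^+ d * qeval L (- m%:Z) g
                        = (chiIntP rho V m g)%:R * (detrho rho g)%:~R}).
Proof.
move=> rho1 rhoM rho_h V_neq0 V_height V_full V_inv.
set N := exponent G.
have N_gt0 : (0 < N)%N by exact: exponent_gt0.
have rhoX g j : g \in G -> rho (g ^+ j)%g = rho g ^+ j.
  move=> gG; elim: j => [|j IH]; first by rewrite expg0 expr0.
  by rewrite expgS exprS rhoM ?groupX // IH.
have rhoN g : g \in G -> rho g ^+ N = 1.
  by move=> gG; rewrite -rhoX // expg_exponent.
have A_cone g : g \in G -> forall y, in_cone (toQ (gen_mx V)) y ->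
    in_cone (toQ (gen_mx V)) (y *m (toQ (rho g))^T).
  move=> gG _ [l l_ge0 ->].
  have -> : l *m toQ (gen_mx V) *m (toQ (rho g))^T =
      \sum_i l 0 i *: (toQ (rho g) *m ratmx (nth 0 V i))^T.
    rewrite [l *m _]mulmx_sum_row mulmx_suml; apply: eq_bigr => i _.
    rewrite -scalemxAl trmx_mul; congr (_ *: (_ *m _)).
    by apply/rowP => j; rewrite !mxE.
  elim/big_rec: _ => [|i x _ xC].
    by exists 0 => [i|]; rewrite ?mul0mx ?mxE.
  apply: in_coneD => //; apply: in_coneZ => //.
  have : in_hull 1 V (ratmx (nth 0 V i)).
    apply/(in_hullP V_neq0 V_height) => //; split; last by rewrite mxE V_height // mem_nth.
    exists (delta_mx 0 i) => [j|]; first by rewrite mxE ler0n.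
    by rewrite -rowE; apply/rowP => j; rewrite !mxE.
  by move=> /(V_inv g gG)/(in_hullP V_neq0 V_height _ ler01)[].
have conjE x y : x \in G -> y \in G ->
    rho (x ^ y)%g *m rho y^-1%g = rho y^-1%g *m rho x.
  by move=> xG yG; rewrite -!rhoM ?groupV ?groupJ // conjgE -!mulgA mulgV mulg1.
have rho_inj y : y \in G -> injective (mulmx (rho y^-1%g) : 'cV[int]_(d + 1) -> _).
  move=> yG x x' E; have := congr1 (mulmx (rho y)) E.
  by rewrite !mulmxA -rhoM ?groupV // mulgV rho1 !mul1mx.
have fix_act x y (p : 'cV[int]_(d + 1)) : x \in G -> y \in G ->
    rho x *m p == p -> rho (x ^ y)%g *m (rho y^-1%g *m p) == rho y^-1%g *m p.
  by move=> xG yG /eqP px; rewrite mulmxA conjE // -mulmxA px.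
(* Acting by [y^-1] injects the points fixed by [x] into those fixed by [x ^ y]; conjugating back
   gives equality in [chiJ]. *)
have chi_le m x y : x \in G -> y \in G -> (chiP rho V m x <= chiP rho V m (x ^ y)%g)%N.
  move=> xG yG; have yVG : y^-1%g \in G by rewrite groupV.
  apply: leq_count_inj (box_uniq _ _) (rho_inj y yG) _ => p /andP[/pboolP pP px].
  have pP' := in_mP_act V_neq0 V_height (rho_h _ yVG) (A_cone _ yVG) pP.
  rewrite fix_act // andbT; apply/andP; split; first exact/pboolP.
  by have [pC pm] := (in_mPP V_neq0 V_height _ _).1 pP'; apply: (cone_box V_height).
have chi_int_le m x y : (0 < m)%N -> x \in G -> y \in G ->
    (chiIntP rho V m x <= chiIntP rho V m (x ^ y)%g)%N.
  move=> m_gt0 xG yG; have yVG : y^-1%g \in G by rewrite groupV.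
  apply: leq_count_inj (box_uniq _ _) (rho_inj y yG) _ => p /andP[/pboolP pP px].
  have pP' := in_int_mP_act V_neq0 V_height V_full N_gt0 (rhoN _ yVG) (rho_h _ yVG) (A_cone _ yVG) m_gt0 pP.
  rewrite fix_act // andbT; apply/andP; split; first exact/pboolP.
  by have [pC pm] := (in_mPP V_neq0 V_height _ _).1 pP'.1; apply: (cone_box V_height).
have chiJ m x y : x \in G -> y \in G -> chiP rho V m (x ^ y)%g = chiP rho V m x.
  move=> xG yG; apply/eqP; rewrite eqn_leq chi_le // andbT.
  by rewrite -{2}(conjgK y x) chi_le ?groupJ ?groupV.
have chi_intJ m x y : (0 < m)%N -> x \in G -> y \in G ->
    chiIntP rho V m (x ^ y)%g = chiIntP rho V m x.
  move=> m_gt0 xG yG; apply/eqP; rewrite eqn_leq chi_int_le // andbT.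
  by rewrite -{2}(conjgK y x) chi_int_le ?groupJ ?groupV.
have detJ x y : x \in G -> y \in G -> detrho rho (x ^ y)%g = detrho rho x.
  move=> xG yG; rewrite /detrho -!det_height_preserving; try by apply: rho_h; rewrite ?groupJ.
  rewrite conjgE !rhoM ?groupM ?groupV // !det_mulmx mulrCA -det_mulmx -rhoM ?groupV //.
  by rewrite mulVg rho1 det1 mulr1.
have H g : exists c : nat -> int -> algC, g \in G -> [/\ forall i m, c i (m + N%:Z) = c i m,
    forall m : nat, \sum_(i < d.+1) c i m%:Z * m%:R ^+ i = (chiP rho V m g)%:R,
    forall m : nat, (0 < m)%N ->
      (-1) ^+ d * \sum_(i < d.+1) c i (- m%:Z) * (- m%:R) ^+ i =
      (chiIntP rho V m g)%:R * (detrho rho g)%:~R &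
    rho g = 1 -> 0 < c d 0].
  case: (boolP (g \in G)) => gG; last by exists (fun _ _ => 0).
  have [c Hc] := fixed_quasipoly V_neq0 V_height V_full N_gt0 (rhoN g gG) (rho_h g gG) (A_cone g gG) (erefl (rho g)).
  by exists c.
have [c Hc] := fin_all_exists H.
(* The coefficients were chosen element by element and need not agree on conjugates, so those of a
   class representative are used. *)
pose f i m g : algC := if g \in G then c (repr (g ^: G)%g) i m else 0.
have fJ i m : {in G &, forall x y, f i m (x ^ y)%g = f i m x}.
  by move=> x y xG yG; rewrite /f groupJ // xG classGidl.
have f0 i m x : x \notin G -> f i m x = 0 by rewrite /f => /negbTE ->.
have fP i m : is_class_fun <<G>>%g [ffun x => f i m x].
  by rewrite genGid; apply: intro_class_fun; [exact: fJ | exact: f0].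
pose L (i : 'I_d.+1) m : 'CF(G) := Cfun 0%N (fP i m).
have LE i m g : L i m g = f i m g by rewrite cfunElock.
have Lq m : {in G, forall g, qeval L m g = \sum_(i < d.+1) c (repr (g ^: G)%g) i m * m%:~R ^+ i}.
  by move=> g gG; apply: eq_bigr => i _; rewrite LE /f gG.
have rep g : g \in G -> exists2 y, y \in G & repr (g ^: G)%g = (g ^ y)%g.
  by move=> _; have [y yG E] := repr_class G g; exists y.
have Lchi (m : nat) : {in G, forall g, qeval L m%:Z g = (chiP rho V m g)%:R}.
  move=> g gG; rewrite Lq //; have [y yG ->] := rep g gG.
  have [_ cm _ _] := Hc (g ^ y)%g (groupJ gG yG).
  by rewrite -(chiJ m g y gG yG) -cm.
exists L; split; last split=> //; last split; last split.
- move=> i m; apply/cfun_inP => g gG; rewrite !LE /f gG.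
  have [y yG ->] := rep g gG.
  by have [cper _ _ _] := Hc (g ^ y)%g (groupJ gG yG); rewrite cper.
(* The identity fixes the whole space, so there [K = d] and the top coefficient at [m = 0] is
   positive. *)
- exists 0; apply/eqP => /cfunP/(_ 1%g); rewrite LE cfunE /f group1.
  have [y yG ->] := rep 1%g (group1 G); rewrite conj1g.
  have [_ _ _ pos] := Hc 1%g (group1 G) => E.
  by have := pos rho1; rewrite -[d]/(val (@ord_max d)) E ltxx.
- move=> g gG; rewrite (Lchi 0%N) //.
  have -> : chiP rho V 0 g = 1%N; last by [].
  rewrite /chiP mul0n.
  have -> : box (d + 1) 0 = [:: 0].
    apply: perm_small_eq => //; apply: uniq_perm (box_uniq _ _) _ _ => // x.
    rewrite mem_box inE; apply/forallP/eqP => [H0|-> i]; last by rewrite mxE.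
    by apply/colP => i; have := H0 i; rewrite leqn0 absz_eq0 => /eqP ->; rewrite mxE.
  rewrite /= mulmx0 eqxx andbT addn0; case: pboolP => // -[].
  apply/(in_mPP V_neq0 V_height); split; last by rewrite mxE.
  by exists 0 => [i|]; rewrite ?mul0mx ?mxE // trmx0 map_mx0.
move=> m m_gt0 g gG; rewrite Lq //; have [y yG ->] := rep g gG.
have [_ _ cm _] := Hc (g ^ y)%g (groupJ gG yG).
rewrite -(chi_intJ m g y m_gt0 gG yG) -(detJ g y gG yG) -cm //.
by congr (_ * _); apply: eq_bigr => i _; rewrite mulrNz.
Qed.
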